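(* Let $X$ be a nodal curve. Then conductor-level balancing on meromorphic differentials on the normalization of $X$ coincides with classical residue balancing at the nodes, i.e. with the condition that at each node the residues at its two preimages sum to zero.
   Context: The base field is algebraically closed of characteristic zero. Let $\nu\colon\widetilde{X}\to X$ be the normalization and $\mathfrak{c}=\mathrm{Ann}_{\mathcal{O}_X}(\nu_*\mathcal{O}_{\widetilde{X}}/\mathcal{O}_X)$ the conductor ideal. Conductor-level balancing means imposing on the principal parts of meromorphic differentials on $\widetilde{X}$, at points over singular points of $X$, exactly the linear constraints dictated by the conductor as the minimal annihilation conditions required for the differential to descend to a section of the dualizing sheaf $\omega_X$, and no others. At a node with branches having local parameters $u,v$, the allowed principal parts are those with at most simple poles, $\left(\frac{a}{u}\,du\right)\oplus\left(\frac{b}{v}\,dv\right)$, and residue balancing is $a+b=0$. *)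

(* Defs.v *)
From HB Require Import structures.
From mathcomp Require Import all_boot all_order all_algebra.
From mathcomp Require Import all_classical.

Set Implicit Arguments.
Unset Strict Implicit.
Unset Printing Implicit Defensive.

Import GRing.Theory.
Local Open Scope classical_set_scope.
Local Open Scope ring_scope.

(* A reduced curve over an algebraically closed field k is presented, as in
   Serre, "Groupes algebriques et corps de classes", chapter IV, by
   - the function fields K_i of its irreducible components,
   - its normalization, whose closed points are discrete valuation rings of the
     K_i (all of them but finitely many, for each i),
   - the finite map nu from the normalization to the curve and, at each closed
     point x, the ring of the rational functions regular at x.  *)

Section FunctionField.
Variables (k K : fieldType) (iota : {rmorphism k -> K}).

Definition function_field1 : Prop :=
  exists2 t : K, ~ algebraicOver iota t &
  exists (n : nat) (e : 'I_n -> K), forall z : K,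
  exists p q : 'I_n -> {poly k},
    (forall j, q j != 0) /\
    z = \sum_(j < n)
          (map_poly iota (p j)).[t] / (map_poly iota (q j)).[t] * e j.

Definition is_uniformizer (V : set K) (t : K) : Prop :=
  [/\ V t, ~ V t^-1 &
      forall z : K, z != 0 -> exists (n : int) (w : K),
        [/\ V w, V w^-1 & z = w * t ^ n]].

Definition is_place (V : set K) : Prop :=
  [/\ forall c, V (iota c),
      forall y z, V y -> V z -> V (y - z),
      forall y z, V y -> V z -> V (y * z) &
      exists t, is_uniformizer V t].

(* The maximal ideal of the valuation ring V, and its n-th power. *)
Definition place_ideal (V : set K) : set K :=
  [set z | V z /\ (z = 0 \/ ~ V z^-1)].

Definition place_ideal_pow (V : set K) (n : nat) : set K :=
  [set z | exists2 t, is_uniformizer V t & V (z / t ^+ n)].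

Definition is_derivation (M : lmodType K) (D : K -> M) : Prop :=
  [/\ forall f g, D (f + g) = D f + D g,
      forall f g, D (f * g) = f *: D g + g *: D f &
      forall c, D (iota c) = 0].

(* The module of Kaehler differentials of K over k, by its universal property;
   uniqueness of the factorization follows from kd_span. *)
Record kahler := Kahler {
  kd_mod :> lmodType K;
  kd_d : K -> kd_mod;
  kd_der : is_derivation kd_d;
  kd_span : forall w : kd_mod, exists (n : nat) (f g : 'I_n -> K),
    w = \sum_(j < n) f j *: kd_d (g j);
  kd_univ : forall (M : lmodType K) (D : K -> M), is_derivation D ->
    exists phi : {linear kd_mod -> M}, forall f, D f = phi (kd_d f) }.

Variables (Om : kahler) (V : set K) (u : K).

(* The principal part of w at the place V, in the local parameter u, is
   (sum_j a_j u^(-j-1)) du. *)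
Definition principal_part (w : Om) (a : {poly k}) : Prop :=
  exists2 g : K, w = g *: kd_d Om u &
                 V (g - (map_poly iota a).[u^-1] / u).

Definition regular_diff (w : Om) : Prop := principal_part w 0.

Definition at_most_simple_pole (w : Om) : Prop :=
  exists c : k, principal_part w c%:P.

Definition residue (w : Om) : k :=
  xget 0 [set r | exists2 a : {poly k}, principal_part w a & r = a`_0].

End FunctionField.

Section PowerSeries.
Variable k : fieldType.

(* Power series in two variables x, y: F i j is the coefficient of x^i y^j. *)
Definition series2 := nat -> nat -> k.

Definition s2C (c : k) : series2 :=
  fun i j => if (i == 0)%N && (j == 0)%N then c else 0.
Definition s2X : series2 := fun i j => ((i == 1)%N && (j == 0)%N)%:R.
Definition s2Y : series2 := fun i j => ((i == 0)%N && (j == 1)%N)%:R.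
Definition s2add (F G : series2) : series2 := fun i j => F i j + G i j.
Definition s2sub (F G : series2) : series2 := fun i j => F i j - G i j.
Definition s2mul (F G : series2) : series2 := fun i j =>
  \sum_(a < i.+1) \sum_(b < j.+1) F a b * G (i - a)%N (j - b)%N.

(* The ideals (xy) + (x,y)^n and (xy) of k[[x,y]]. *)
Definition s2_ideal_pow (n : nat) : set series2 :=
  [set F | exists G H : series2,
    F = s2add (s2mul (s2mul s2X s2Y) G) H /\
    forall i j, (i + j < n)%N -> H i j = 0].

Definition s2_ideal : set series2 :=
  [set F | exists G : series2, F = s2mul (s2mul s2X s2Y) G].

End PowerSeries.

Record curve (k : closedFieldType) := Curve {
  component : finType;
  fld : component -> fieldType;
  emb : forall i, {rmorphism k -> fld i};
  fldP : forall i, function_field1 (emb i);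
  (* npt i: closed points of the normalization lying on the component i;
     vring p: the local ring at p *)
  npt : component -> choiceType;
  vring : forall i, npt i -> set (fld i);
  vringP : forall i (p : npt i), is_place (emb i) (vring p);
  vring_inj : forall i, injective (@vring i);
  vring_cofinite : forall i,
    finite_set ([set V | is_place (emb i) V] `\` range (@vring i));
  (* pt: closed points of the curve; reg x f means that the rational function f on the curve is
     regular at x, which puts no condition on the components missing x
     (this follows from reg_conductor) *)
  pt : choiceType;
  nu : {i : component & npt i} -> pt;
  nu_surj : forall x, exists P, nu P = x;
  nu_fin : forall x, finite_set [set P | nu P = x];
  reg : pt -> set (forall i, fld i);
  reg_const : forall x c, reg x (fun i => emb i c);
  reg_sub : forall x f g, reg x f -> reg x g -> reg x (fun i => f i - g i);
  reg_mul : forall x f g, reg x f -> reg x g -> reg x (fun i => f i * g i);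
  reg_vring : forall P f, reg (nu P) f -> vring (tagged P) (f (tag P));
  reg_local : forall x f, reg x f -> exists c : k, forall P, nu P = x ->
    place_ideal (vring (tagged P)) (f (tag P) - emb (tag P) c);
  (* nu is finite and birational, and an isomorphism off a finite set *)
  reg_conductor : forall x, exists n : nat, forall f : (forall i, fld i),
    (forall P, nu P = x ->
       place_ideal_pow (vring (tagged P)) n (f (tag P))) -> reg x f;
  reg_cofinite : finite_set [set x | exists2 f : (forall i, fld i),
    (forall P, nu P = x -> vring (tagged P) (f (tag P))) & ~ reg x f] }.

Section Curve.
Variables (k : closedFieldType) (X : curve k).

Definition ratfun := forall i : component X, fld i.
Definition branch := {i : component X & npt i}.

Definition fibre (x : pt X) : set branch := [set P | nu P = x].

(* The stalk at x of the direct image of the structure sheaf of the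
   normalization. *)
Definition nreg (x : pt X) : set ratfun :=
  [set f | forall P, fibre x P -> vring (tagged P) (f (tag P))].

Definition conductor (x : pt X) : set ratfun :=
  [set f | reg x f /\ forall h, nreg x h -> reg x (fun i => f i * h i)].

Definition max_ideal (x : pt X) : set ratfun :=
  [set f | reg x f /\
    forall P, fibre x P -> place_ideal (vring (tagged P)) (f (tag P))].

Fixpoint max_ideal_pow (x : pt X) (n : nat) : set ratfun :=
  if n is n'.+1 then
    [set f | exists (N : nat) (a b : 'I_N -> ratfun),
      [/\ forall j, max_ideal x (a j),
          forall j, max_ideal_pow x n' (b j) &
          f = (fun i => \sum_(j < N) a j i * b j i)]]
  else reg x.

(* x is a regular point: the maximal ideal of its one-dimensional local ring is
   generated by one element. *)
Definition regular_point (x : pt X) : Prop :=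
  exists2 t, max_ideal x t & forall f, max_ideal x f ->
    exists2 g, reg x g & f = (fun i => g i * t i).

Definition singular (x : pt X) : Prop := ~ regular_point x.

(* The completed local ring at x is isomorphic to k[[x,y]]/(xy): there is a
   k-algebra morphism from the local ring to k[[x,y]]/(xy), given by
   representatives phi f in k[[x,y]], that induces isomorphisms between the
   quotients by the n-th powers of the maximal ideals for all n. *)
Definition node (x : pt X) : Prop :=
  exists phi : ratfun -> series2 k,
  [/\ forall c : k, s2_ideal (s2sub (phi (fun i => emb i c)) (s2C c)),
      forall f g, reg x f -> reg x g ->
        s2_ideal (s2sub (phi (fun i => f i + g i)) (s2add (phi f) (phi g))),
      forall f g, reg x f -> reg x g ->
        s2_ideal (s2sub (phi (fun i => f i * g i)) (s2mul (phi f) (phi g))),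
      forall n f, reg x f -> max_ideal_pow x n f <-> s2_ideal_pow n (phi f) &
      forall n (F : series2 k), exists2 f, reg x f &
        s2_ideal_pow n (s2sub (phi f) F)].

Definition nodal : Prop := forall x : pt X, regular_point x \/ node x.

(* Meromorphic differentials on the normalization are families eta of elements
   of the modules Om i; u P is a local parameter at P. *)
Variables (Om : forall i : component X, kahler (emb i)).
Variable u : forall P : branch, fld (tag P).

Definition merodiff := forall i : component X, Om i.

Definition residue_at (eta : merodiff) (P : branch) : k :=
  residue (vring (tagged P)) (u P) (eta (tag P)).

Definition regular_at (eta : merodiff) (P : branch) : Prop :=
  regular_diff (vring (tagged P)) (u P) (eta (tag P)).

Definition simple_pole_at (eta : merodiff) (P : branch) : Prop :=
  at_most_simple_pole (vring (tagged P)) (u P) (eta (tag P)).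

(* The stalk at x of the dualizing sheaf, as Rosenlicht's regular
   differentials. *)
Definition dualizing (x : pt X) : set merodiff :=
  [set eta | forall f, reg x f ->
    \sum_(P \in fibre x) residue_at (fun i => f i *: eta i) P = 0].

(* The conductor annihilates the principal parts of eta over x. *)
Definition conductor_annihilates (x : pt X) (eta : merodiff) : Prop :=
  forall f, conductor x f ->
  forall P, fibre x P -> regular_at (fun i => f i *: eta i) P.

Definition conductor_balanced (eta : merodiff) : Prop :=
  forall x, singular x -> conductor_annihilates x eta /\ dualizing x eta.

Definition residue_balanced (eta : merodiff) : Prop :=
  forall x, node x -> exists P Q : branch,
    [/\ P <> Q, fibre x = [set P; Q],
        simple_pole_at eta P, simple_pole_at eta Q &
        residue_at eta P + residue_at eta Q = 0].

End Curve.

(* Main.v *)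
(* At a node x, reading off the two axes of k[[x,y]]/(xy) embeds the completed
   local ring into k[[T]] x k[[T]].  Multiplying by an element w of the conductor
   extends each coordinate to the semilocal ring of the normalization; its
   constant term is a k-algebra morphism to k, and the joint kernel of the two
   morphisms is the Jacobson radical J.  Hence there are exactly two points P, Q
   over x, their residue fields are k, and the local ring contains J, so the
   conductor is J = m_P /\ m_Q.  Being killed by J means having at most simple
   poles at P and Q; for such differentials the residues of f eta at P and Q are
   those of eta multiplied by the common value f(x), so Rosenlicht's condition
   reduces to f = 1.

   Residues are well defined because du <> 0: differentiating Laurent approximations
   in u is a derivation of K into sequences modulo null sequences, and it does
   not kill u. *)

Require Import Defs.
From HB Require Import structures.
From mathcomp Require Import all_boot all_order all_algebra.
From mathcomp Require Import all_classical.
From mathcomp Require Import generic_quotient ring_quotient.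
From mathcomp Require Import ring zify.

Set Implicit Arguments.
Unset Strict Implicit.
Unset Printing Implicit Defensive.

Import Order.TTheory GRing.Theory Num.Theory.
Local Open Scope classical_set_scope.
Local Open Scope ring_scope.
Local Open Scope quotient_scope.

(** * Discrete valuation rings *)

(** Each [a] excludes at most one value, so finitely many are excluded in all; a root of [p + 1],
    where [p] vanishes at the excluded values, avoids them. *)
Lemma closed_field_avoid (k : closedFieldType) (T : eqType) (s : seq T)
    (bad : T -> k -> Prop) :
    (forall a c d, bad a c -> bad a d -> c = d) ->
  exists c, forall a, a \in s -> ~ bad a c.
Proof.
move=> bad1; pose b a := xget 0 (bad a).
pose p := \prod_(a <- s) ('X - (b a)%:P) : {poly k}.
have [c c_b] : exists c, c \notin map b s.
  have [->|s0] := eqVneq s [::]; first by exists 0.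
  have sp : size p = (size s).+1 by rewrite /p size_prod_XsubC.
  have /closed_rootP [c rc] : size (p + 1) != 1%N.
    rewrite size_polyDl ?sp ?size_poly1 //; last by case: (s) s0.
    by case: (s) s0.
  exists c; apply/negP => /mapP[a as_ cE]; move: rc.
  rewrite /root hornerD hornerE horner_prod (perm_big _ (perm_to_rem as_)) big_cons /=.
  by rewrite hornerXsubC cE subrr mul0r add0r oner_eq0.
exists c => a as_ bac; move/negP: c_b; apply; apply/mapP; exists a => //.
by rewrite /b (xget_subset1 0 bac) // => d e; apply: bad1.
Qed.

Section Place.
Variables (k K : fieldType) (iota : {rmorphism k -> K}) (V : set K).
Hypothesis hV : is_place iota V.

Lemma place_const c : V (iota c). Proof. by case: hV. Qed.
Lemma place_sub y z : V y -> V z -> V (y - z).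
Proof. by case: hV => _ + _ _; apply. Qed.
Lemma place_mul y z : V y -> V z -> V (y * z).
Proof. by case: hV => _ _ + _; apply. Qed.
Lemma place0 : V 0. Proof. by rewrite -(rmorph0 iota); apply: place_const. Qed.
Lemma place1 : V 1. Proof. by rewrite -(rmorph1 iota); apply: place_const. Qed.
Lemma place_opp y : V y -> V (- y).
Proof. by rewrite -sub0r; apply: place_sub place0. Qed.
Lemma place_add y z : V y -> V z -> V (y + z).
Proof. by move=> Vy /place_opp Vz; rewrite -[z]opprK; apply: place_sub. Qed.
Lemma place_exp y n : V y -> V (y ^+ n).
Proof.
by move=> Vy; elim: n => [|n IH]; rewrite ?expr0 ?exprS; [exact: place1|exact: place_mul].
Qed.
Lemma place_nat n : V n%:R.
Proof. by rewrite -(rmorph_nat iota); apply: place_const. Qed.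

Section Uniformizer.
Variable t : K.
Hypothesis ht : is_uniformizer V t.

Lemma uniformizer_neq0 : t != 0.
Proof. by apply/eqP => t0; case: ht => _ + _; rewrite t0 invr0; case; exact: place0. Qed.
Let t0 := uniformizer_neq0.

Lemma uniformizer_in : V t. Proof. by case: ht. Qed.

Lemma uniformizer_pos n : ~ V (t ^- n.+1).
Proof.
case: ht => Vt Nt _ /(place_mul (place_exp n Vt)); congr (~ (V _)): Nt.
by rewrite exprS; field; rewrite expf_neq0.
Qed.

Lemma place_cases z : z != 0 -> exists (n : nat) (w : K),
  [/\ w != 0, V w, V w^-1 & z = w * t ^+ n \/ z = w * t ^- n].
Proof.
move=> z0; case: ht => _ _ /(_ _ z0) [n [w [Vw Vw' zE]]].
have w0 : w != 0 by apply: contra_neq z0 => w0; rewrite zE w0 mul0r.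
case: n zE => n zE; first by exists n, w; split=> //; left.
by exists n.+1, w; split=> //; right; rewrite zE NegzE -exprnN.
Qed.

Lemma place_total z : V z \/ V z^-1.
Proof.
have [->|z0] := eqVneq z 0; first by left; exact: place0.
have [n [w [w0 Vw Vw' [->|->]]]] := place_cases z0; [left|right].
  by apply: place_mul => //; apply: place_exp; exact: uniformizer_in.
rewrite invfM invrK.
by apply: place_mul => //; apply: place_exp; exact: uniformizer_in.
Qed.

Lemma place_idealP z : place_ideal V z <-> V (z / t).
Proof.
split.
  case=> Vz [->|NV]; first by rewrite mul0r; exact: place0.
  have z0 : z != 0 by apply: contra_not_neq NV => ->; rewrite invr0; exact: place0.
  have [n [w [w0 Vw Vw' [zE|zE]]]] := place_cases z0.
    case: n zE => [|n] zE; first by case: NV; rewrite zE expr0 mulr1.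
    have -> : z / t = w * t ^+ n by rewrite zE exprSr; field.
    by apply: place_mul => //; apply: place_exp; exact: uniformizer_in.
  by case: NV; rewrite zE invfM invrK; apply: place_mul => //; apply: place_exp;
    exact: uniformizer_in.
move=> Vzt; split.
  by have := place_mul Vzt uniformizer_in; rewrite divfK.
have [->|z0] := eqVneq z 0; [by left|right => Vz].
apply: (@uniformizer_pos 0); have := place_mul Vzt Vz; congr V.
by rewrite expr1; field; rewrite z0 t0.
Qed.

Lemma uniformizer_weaken n m z : (n <= m)%N -> V (z / t ^+ m) -> V (z / t ^+ n).
Proof.
move=> nm /(place_mul (place_exp (m - n) uniformizer_in)); congr V.
rewrite -{2}(subnK nm) exprD; field; by rewrite !expf_neq0.
Qed.

Lemma place_ideal_powP n z : V (z / t ^+ n) -> place_ideal_pow V n z.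
Proof. by exists t. Qed.

Lemma place_div w : w != 0 -> exists C : nat, forall m f,
  V (w * f / t ^+ (C + m)) -> V (f / t ^+ m).
Proof.
move=> w0; have [n [v [v0 Vv Vv' wE]]] := place_cases w0.
have tn n' : t ^+ n' != 0 by rewrite expf_neq0.
exists n => m f Vf; have := place_mul Vv' Vf.
case: wE => ->; last first.
  move=> /(place_mul (place_exp (n + n) uniformizer_in)); congr V.
  by rewrite !exprD; field; rewrite !tn v0.
by congr V; rewrite exprD; field; rewrite !tn v0.
Qed.

End Uniformizer.

Lemma place_uniformizer : exists t, is_uniformizer V t. Proof. by case: hV. Qed.

Lemma placeV_total z : V z \/ V z^-1.
Proof. by have [t /place_total] := place_uniformizer. Qed.

Lemma place_ideal_in z : place_ideal V z -> V z. Proof. by case. Qed.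

Lemma place_unit_inv z : V z -> ~ place_ideal V z -> z != 0 /\ V z^-1.
Proof.
move=> Vz NI; split; first by apply: contra_not_neq NI => ->; split; [exact: place0|left].
by apply: contrapT => NV; apply: NI; split=> //; right.
Qed.

Lemma place_ideal0 : place_ideal V 0.
Proof. by split; [exact: place0|left]. Qed.

Lemma place_idealB y z : place_ideal V y -> place_ideal V z -> place_ideal V (y - z).
Proof.
have [t ht] := place_uniformizer.
by rewrite !(place_idealP ht) mulrBl; apply: place_sub.
Qed.

Lemma place_idealM y z : V y -> place_ideal V z -> place_ideal V (y * z).
Proof.
have [t ht] := place_uniformizer.
by rewrite !(place_idealP ht) -mulrA; apply: place_mul.
Qed.

Lemma place_idealN y : place_ideal V y -> place_ideal V (- y).
Proof. by rewrite -sub0r; apply: place_idealB place_ideal0. Qed.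

Lemma place_idealD y z : place_ideal V y -> place_ideal V z -> place_ideal V (y + z).
Proof. by move=> Iy /place_idealN Iz; rewrite -[z]opprK; apply: place_idealB. Qed.

Lemma place_ideal1 : ~ place_ideal V 1.
Proof. by case=> _ [/eqP|]; rewrite ?oner_eq0 // invr1; apply; exact: place1. Qed.

Lemma place_ideal_prime y z : V y -> V z -> place_ideal V (y * z) ->
  place_ideal V y \/ place_ideal V z.
Proof.
move=> Vy Vz Iyz; have [|/(place_unit_inv Vy) [y0 Vy']] := pselect (place_ideal V y).
  by left.
by right; rewrite -(mulKf y0 z); apply: place_idealM.
Qed.

Lemma place_ideal_exp y n : V y -> place_ideal V (y ^+ n) -> place_ideal V y.
Proof.
move=> Vy; elim: n => [|n IH]; first by rewrite expr0 => /place_ideal1.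
by rewrite exprS => /(place_ideal_prime Vy (place_exp n Vy)) [|/IH].
Qed.

Lemma place_ideal_const c : place_ideal V (iota c) -> c = 0.
Proof.
move=> Ic; apply/eqP; apply: contrapT => /negP c0; apply: place_ideal1.
by rewrite -(rmorph1 iota) -(mulVf c0) rmorphM; apply: place_idealM => //; exact: place_const.
Qed.

Lemma place_const_unique y c d :
  place_ideal V (y - iota c) -> place_ideal V (y - iota d) -> c = d.
Proof.
move=> Ic Id; apply/eqP; rewrite -subr_eq0; apply/eqP/place_ideal_const.
by have := place_idealB Id Ic; congr place_ideal; rewrite rmorphB; ring.
Qed.

Lemma place_idealC y c : ~ V (y - iota c)^-1 -> place_ideal V (y - iota c).
Proof. by move=> NV; split; [case: (placeV_total (y - iota c))|right]. Qed.

(** Residues are unique, so [(y - iota c)^-1] fails to be regular for at most one [c]; this feeds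
    [closed_field_avoid]. *)
Lemma place_inv_sub_unique y c d :
  ~ V (y - iota c)^-1 -> ~ V (y - iota d)^-1 -> c = d.
Proof. by move=> /place_idealC Ic /place_idealC; apply: place_const_unique. Qed.

(** Discrete valuation rings are maximal proper subrings: an element of [V'] outside [V] puts
    [t^-1], hence the whole field, in [V']. *)
Lemma place_subset_eq V' : is_place iota V' -> V `<=` V' -> V = V'.
Proof.
move=> hV' sub; apply/seteqP; split=> // y Vy'; apply: contrapT => NVy.
have [t' ht'] : exists t, is_uniformizer V' t by case: hV'.
have [t ht] := place_uniformizer.
have y0 : y != 0 by apply: contra_not_neq NVy => ->; exact: place0.
have t0 := uniformizer_neq0 ht.
have V't : V' t^-1.
  have : place_ideal V y^-1.
    by split; [case: (placeV_total y)|right; rewrite invrK].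
  move=> /(place_idealP ht)/sub Vyt.
  case: hV' => _ _ mulV' _.
  by have := mulV' _ _ Vy' Vyt; rewrite mulrA divff ?mul1r.
case: (ht') => _ + _; apply.
have t'0 : t' != 0.
  by case: ht' => _ + _; apply: contra_not_neq => ->; rewrite invr0; apply: sub; exact: place0.
have mulV' : forall y z, V' y -> V' z -> V' (y * z) by case: hV'.
have V'tn n : V' (t ^- n).
  elim: n => [|n IH]; first by rewrite expr0 invr1; apply: sub; exact: place1.
  by rewrite exprS invfM; apply: mulV'.
have t'V0 : t'^-1 != 0 by rewrite invr_eq0.
have [n [w [w0 Vw Vw' [->|->]]]] := place_cases ht t'V0; apply: mulV' => //; apply: sub => //.
by apply: place_exp; exact: uniformizer_in ht.
Qed.

End Place.

(** * A derivation not killing a uniformizer *)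

(** Induction on the places: a pole [t^-1] at the new place is added with a coefficient [c]. Where
    [y] and [t^-1] are not both regular, at most one [c] makes the sum regular. *)
Lemma common_pole (k : closedFieldType) (K : fieldType) (iota : {rmorphism k -> K})
    (T : eqType) (Vr : T -> set K) (s : seq T) :
  (forall a, is_place iota (Vr a)) -> exists y, forall a, a \in s -> ~ Vr a y.
Proof.
move=> hV; elim: s => [|b s [y IH]]; first by exists 0.
have [t [_ Nt _]] := place_uniformizer (hV b).
pose bad a c := Vr a (y + iota c * t^-1) /\ ~ (Vr a y /\ Vr a t^-1).
have [|c cgood] := @closed_field_avoid k T (b :: s) bad.
  move=> a c d [Vc NV] [Vd _]; apply/eqP; apply: contrapT => /negP cd; apply: NV.
  have cd0 : iota (d - c) != 0 by rewrite fmorph_eq0 subr_eq0 eq_sym.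
  suff Vt : Vr a t^-1.
    split=> //; have := place_sub (hV a) Vc (place_mul (hV a) (place_const (hV a) c) Vt).
    by rewrite addrK.
  have := place_mul (hV a) (place_const (hV a) (d - c)^-1) (place_sub (hV a) Vd Vc).
  congr (Vr a _); rewrite fmorphV [X in _ * X](_ : _ = iota (d - c) * t^-1) ?mulKf //.
  by rewrite rmorphB; ring.
exists (y + iota c * t^-1) => a as_ Va; apply: (cgood a as_); split=> // -[Vy Vt].
by move: as_; rewrite inE => /orP[/eqP ab|/IH //]; rewrite ab in Vt.
Qed.

(** * Sequences modulo null sequences *)

Section NullSequences.
Variables (k K : fieldType) (iota : {rmorphism k -> K}) (V : set K) (t : K).
Hypotheses (hV : is_place iota V) (ht : is_uniformizer V t).

Definition null_seq (s : nat -> K) : Prop :=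
  forall m : nat, exists n0 : nat, forall n, (n0 <= n)%N -> V (s n / t ^+ m).

Definition null_pred : pred (nat -> K) := fun s => `[< null_seq s >].

Lemma null_seqB s s' : null_seq s -> null_seq s' -> null_seq (s - s').
Proof.
move=> Ns Ns' m; have [n Hn] := Ns m; have [n' Hn'] := Ns' m.
exists (maxn n n') => i; rewrite geq_max => /andP[/Hn Vs /Hn' Vs'].
by rewrite -[(s - s') i]/(s i - s' i) mulrBl; apply: (place_sub hV).
Qed.

Lemma pole_bound y : exists C : nat, V (y * t ^+ C).
Proof.
have Vtn n : V (t ^+ n) by exact/(place_exp hV)/(uniformizer_in ht).
have [->|y0] := eqVneq y 0; first by exists 0%N; rewrite mul0r; exact: place0 hV.
have [N [w [w0 Vw Vw' [->|->]]]] := place_cases ht y0; exists N.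
  by apply: (place_mul hV) => //; apply: (place_mul hV).
by rewrite mulfVK // expf_neq0 // (uniformizer_neq0 hV ht).
Qed.

Lemma null_seqM a s : null_seq s -> null_seq (fun n => a * s n).
Proof.
have [C HC] := pole_bound a.
move=> Ns m; have [n0 Hn0] := Ns (C + m)%N; exists n0 => n /Hn0 Vs.
have := place_mul hV HC Vs; congr V; rewrite exprD; field.
by rewrite !expf_neq0 // (uniformizer_neq0 hV ht).
Qed.

Lemma null_zmod_closed : zmod_closed null_pred.
Proof.
split; last by move=> s s' /asboolP Ns /asboolP Ns'; apply/asboolP; exact: null_seqB.
by apply/asboolP => m; exists 0%N => n _; rewrite mul0r; exact: place0 hV.
Qed.

Definition null_zmod : zmodClosed (nat -> K) :=
  HB.pack_for (zmodClosed (nat -> K)) null_pred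
    (GRing.isZmodClosed.Build (nat -> K) null_pred null_zmod_closed).

(** The classes of Cauchy sequences form the completion of [K] at [V], so a derivation into this
    module can be defined through approximations. *)
Definition germs := Quotient.quot null_zmod.
HB.instance Definition _ := GRing.Zmodule.on germs.

Definition germ (s : nat -> K) : germs := \pi_(Quotient.quot null_zmod) s.

Lemma germ_eq s s' : null_seq (s - s') -> germ s = germ s'.
Proof. by move=> Ns; apply/eqP; rewrite -Quotient.idealrBE; apply/asboolP. Qed.

Lemma germ_add s s' : germ (s + s') = germ s + germ s'.
Proof. by rewrite /germ raddfD. Qed.

Lemma germ_repr (g : germs) : germ (repr g) = g.
Proof. exact: reprK. Qed.

Definition germ_scale (a : K) (g : germs) : germs := germ (fun n => a * repr g n).

Lemma germ_scaleE a s : germ_scale a (germ s) = germ (fun n => a * s n).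
Proof.
apply: germ_eq.
have : null_seq (repr (germ s) - s).
  by apply/asboolP; rewrite -[X in is_true X]/(_ \in null_zmod) Quotient.idealrBE reprK.
by move=> /(null_seqM a); congr null_seq; apply/funext => n; rewrite /= mulrBr.
Qed.

Lemma germ_scaleA a b g : germ_scale a (germ_scale b g) = germ_scale (a * b) g.
Proof.
rewrite -[g]germ_repr !germ_scaleE; congr germ; apply/funext => n.
by rewrite mulrA.
Qed.

Lemma germ_scale1 : left_id 1 germ_scale.
Proof.
move=> g; rewrite -[g]germ_repr germ_scaleE; congr germ; apply/funext => n.
by rewrite mul1r.
Qed.

Lemma germ_scaleDr : right_distributive germ_scale +%R.
Proof.
move=> a g h; rewrite -[g]germ_repr -[h]germ_repr -germ_add !germ_scaleE -germ_add.
by congr germ; apply/funext => n; rewrite -[(_ + _) n]/(_ n + _ n) mulrDr.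
Qed.

Lemma germ_scaleDl g : {morph germ_scale^~ g : a b / a + b}.
Proof.
move=> a b; rewrite -[g]germ_repr !germ_scaleE -germ_add.
by congr germ; apply/funext => n; rewrite mulrDl.
Qed.

HB.instance Definition _ := GRing.Zmodule_isLmodule.Build K germs
  germ_scaleA germ_scale1 germ_scaleDr germ_scaleDl.


(** * Laurent polynomials in the uniformizer *)

Hypothesis res : forall y, V y -> exists c, V ((y - iota c) / t).

Let t0 : t != 0 := uniformizer_neq0 hV ht.
Let tn0 n : t ^+ n != 0. Proof. by rewrite expf_neq0. Qed.
Let Vtn n : V (t ^+ n). Proof. exact/(place_exp hV)/(uniformizer_in ht). Qed.

Definition eval (p : {poly k}) : K := (map_poly iota p).[t].

Lemma evalD p q : eval (p + q) = eval p + eval q.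
Proof. by rewrite /eval rmorphD hornerD. Qed.
Lemma evalB p q : eval (p - q) = eval p - eval q.
Proof. by rewrite /eval rmorphB hornerD hornerN. Qed.
Lemma evalM p q : eval (p * q) = eval p * eval q.
Proof. by rewrite /eval rmorphM hornerM. Qed.
Lemma evalC c : eval c%:P = iota c.
Proof. by rewrite /eval map_polyC hornerC. Qed.
Lemma evalX : eval 'X = t.
Proof. by rewrite /eval map_polyX hornerX. Qed.
Lemma evalXn n : eval 'X^n = t ^+ n.
Proof. by rewrite /eval map_polyXn hornerXn. Qed.
Definition evalE := (evalB, evalD, evalM, evalC, evalX, evalXn).

(** The value at [t] of the operator t d/dt, which scales ['X^n] by [n] and so keeps divisibility by
    powers of ['X]. *)
Definition euler (p : {poly k}) : K := t * eval p^`().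

Lemma eulerB p q : euler (p - q) = euler p - euler q.
Proof. by rewrite /euler derivB evalB mulrBr. Qed.
Lemma eulerM p q : euler (p * q) = euler p * eval q + eval p * euler q.
Proof. by rewrite /euler derivM !evalE; ring. Qed.
Lemma eulerC c : euler c%:P = 0.
Proof. by rewrite /euler derivC -polyC0 evalC rmorph0 mulr0. Qed.
Lemma eulerX : euler 'X = t.
Proof. by rewrite /euler derivX -polyC1 evalC rmorph1 mulr1. Qed.
Lemma eulerXn n : euler 'X^n = n%:R * t ^+ n.
Proof.
elim: n => [|n IH]; first by rewrite expr0 -polyC1 eulerC mul0r.
by rewrite exprS eulerM IH !evalE eulerX -natr1 exprS; ring.
Qed.
Definition eulerE := (eulerB, eulerM, eulerC, eulerX, eulerXn).

Lemma eval_in p : V (eval p).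
Proof.
elim/poly_ind: p => [|p c IH]; first by rewrite -polyC0 evalC; exact: place_const.
rewrite !evalE; apply: (place_add hV); last exact: place_const.
by apply: (place_mul hV) => //; exact: uniformizer_in ht.
Qed.

Lemma eval_dvdXn p n : V (eval p / t ^+ n) -> exists q, p = q * 'X^n.
Proof.
elim: n => [|n IH]; first by exists p; rewrite expr0 mulr1.
move=> Vp; have [q pE] := IH (uniformizer_weaken hV ht (leqnSn n) Vp).
elim/poly_ind: q pE => [|q c _] pE; first by exists 0; rewrite pE !mul0r.
suff c0 : c = 0 by exists q; rewrite pE c0 addr0 -mulrA exprS.
apply: (place_ideal_const hV); apply/(place_idealP hV ht).
have := place_sub hV Vp (eval_in q); congr V.
by rewrite pE !evalE exprS; field; rewrite t0 tn0.
Qed.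

Lemma taylor_approx y n : V y -> exists p, V ((y - eval p) / t ^+ n).
Proof.
move=> Vy; elim: n => [|n [p /res[c Vc]]].
  by exists 0; rewrite -polyC0 evalC rmorph0 subr0 expr0 divr1.
exists (p + c%:P * 'X^n); move: Vc; congr V; rewrite !evalE exprS; field.
by rewrite t0 tn0.
Qed.

(* y is a Laurent polynomial in t with formal derivative s; the representation
   of y as p(t) / t^N is not unique, so this is a relation *)
Definition laurent_deriv (y s : K) : Prop := exists p N,
  y = eval p / t ^+ N /\ s = (euler p - N%:R * eval p) / t ^+ N.+1.

Lemma laurent_derivC c : laurent_deriv (iota c) 0.
Proof.
exists c%:P, 0%N; split; first by rewrite evalC expr0 divr1.
by rewrite eulerC !mul0r subr0 mul0r.
Qed.

Lemma laurent_derivX : laurent_deriv t 1.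
Proof.
exists 'X, 0%N; split; first by rewrite evalX expr0 divr1.
by rewrite eulerX mul0r subr0 expr1 divff.
Qed.

Lemma laurent_derivB y s y' s' : laurent_deriv y s -> laurent_deriv y' s' ->
  laurent_deriv (y - y') (s - s').
Proof.
move=> [p [N [-> ->]]] [q [M [-> ->]]].
exists (p * 'X^M - q * 'X^N), (N + M)%N.
rewrite !eulerE !evalE natrD !exprS exprD.
by split; field; rewrite ?t0 ?tn0 ?t0.
Qed.

Lemma laurent_derivM y s y' s' : laurent_deriv y s -> laurent_deriv y' s' ->
  laurent_deriv (y * y') (y * s' + y' * s).
Proof.
move=> [p [N [-> ->]]] [q [M [-> ->]]].
exists (p * q), (N + M)%N.
rewrite !eulerE !evalE natrD !exprS exprD.
by split; field; rewrite ?t0 ?tn0 ?t0.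
Qed.

(** The operator t d/dt does not lower the order, so the derivative lowers it by at most one.
    Applied to differences, this shows that close approximations have close derivatives. *)
Lemma laurent_deriv_order y s (n : int) : laurent_deriv y s -> V (y * t ^ n) ->
  V (s * t ^ (n + 1)).
Proof.
move=> [p [N [-> ->]]].
have -> : eval p / t ^+ N * t ^ n = eval p * t ^ (n - N%:Z).
  by rewrite expfzDr // mulrAC mulrA -exprnN.
have -> : (euler p - N%:R * eval p) / t ^+ N.+1 * t ^ (n + 1) =
    (euler p - N%:R * eval p) * t ^ (n - N%:Z).
  rewrite !expfzDr // expr1z -exprnN exprS.
  by field; rewrite t0 tn0.
case: (n - N%:Z) => [m _|m].
  apply: (place_mul hV) (Vtn m); apply: (place_sub hV); apply: (place_mul hV).
  - exact: uniformizer_in ht.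
  - exact: eval_in.
  - exact: place_nat hV N.
  - exact: eval_in.
(* For a negative exponent, integrality forces a power of ['X] to divide [p]; this factor survives
   [euler] and cancels the denominator. *)
rewrite NegzE -exprnN => /eval_dvdXn[q ->].
set M := m.+1; rewrite !eulerE !evalE.
have -> : (euler q * t ^+ M + eval q * (M%:R * t ^+ M) - N%:R * (eval q * t ^+ M))
    * t ^- M = t * eval q^`() + (M%:R - N%:R) * eval q.
  by rewrite /euler; field; rewrite tn0.
apply: (place_add hV); apply: (place_mul hV); try exact: eval_in.
  exact: uniformizer_in ht.
by apply: (place_sub hV); exact: place_nat hV _.
Qed.

Lemma laurent_approx (y : K) (n : nat) :
  exists z : K * K, laurent_deriv z.1 z.2 /\ V ((y - z.1) / t ^+ n).
Proof.
have [N VyN] := pole_bound y.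
have [p Vp] := taylor_approx (N + n) VyN.
exists (eval p / t ^+ N, (euler p - N%:R * eval p) / t ^+ N.+1); split.
  by exists p, N.
by move: Vp; congr V; rewrite exprD /=; field; rewrite !tn0.
Qed.

(** * The derivation given by Laurent approximations *)

Let approx y n : K * K := projT1 (cid (laurent_approx y n)).
Let approxP y n : laurent_deriv (approx y n).1 (approx y n).2.
Proof. by rewrite /approx; case: cid => z []. Qed.
Let approx_in y n : V ((y - (approx y n).1) * t ^ (- n%:Z)).
Proof. by rewrite /approx -exprnN; case: cid => z []. Qed.

(** The approximations are chosen arbitrarily; by [laurent_deriv_order] another choice changes the
    sequence by a null sequence. *)
Definition germ_deriv (y : K) : germs := germ (fun n => (approx y n).2).

Let Vz (m n : int) y : (m <= n)%R -> V (y * t ^ m) -> V (y * t ^ n).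
Proof.
move=> mn Vy; have -> : n = m + `|(n - m)%R|%N by rewrite gez0_abs ?subr_ge0 // addrC subrK.
by rewrite expfzDr // mulrA; apply: (place_mul hV) => //; exact: Vtn.
Qed.

Lemma null_seq_order (s : nat -> K) (C : nat) :
  (forall n : nat, V (s n * t ^ (C%:Z - n%:Z))) -> null_seq s.
Proof.
move=> Vs m; exists (C + m)%N => n Hn; rewrite -[_ / _]/(s n * (t ^+ m)^-1) exprnN.
by apply: Vz (Vs n); lia.
Qed.

Lemma germ_derivD f g : germ_deriv (f + g) = germ_deriv f + germ_deriv g.
Proof.
rewrite -germ_add; apply: germ_eq; apply: (@null_seq_order _ 1) => n.
rewrite -[(_ - _) n]/((approx (f + g) n).2 - ((approx f n).2 + (approx g n).2)).
rewrite opprD addrA [1%:Z - _]addrC.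
apply: laurent_deriv_order.
  by apply: laurent_derivB; [apply: laurent_derivB|]; exact: approxP.
have := place_sub hV (place_add hV (approx_in f n) (approx_in g n)) (approx_in (f + g) n).
by congr V; ring.
Qed.

Lemma germ_derivM f g :
  germ_deriv (f * g) = f *: germ_deriv g + g *: germ_deriv f.
Proof.
rewrite -[f *: _]/(germ_scale _ _) -[g *: _]/(germ_scale _ _) !germ_scaleE -germ_add.
apply: germ_eq.
(* [C] bounds the poles of [f] and [g], hence those of all their approximations; derivatives may
   lose one order more. *)
have [C [VfC VgC]] : exists C : nat, V (f * t ^ C) /\ V (g * t ^ C).
  have [[C VC] [D VD]] := (pole_bound f, pole_bound g).
  exists (C + D)%N; split.
    by apply: (@Vz C) VC; lia.
  by apply: (@Vz D) VD; lia.
have bound y n : V (y * t ^ C) -> V ((approx y n).1 * t ^ C).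
  move=> Vy; have Vd : V ((y - (approx y n).1) * t ^ C).
    by apply: Vz (approx_in y n); lia.
  by have := place_sub hV Vy Vd; rewrite -mulrBl opprB addrC subrK.
have boundd y n : V (y * t ^ C) -> V ((approx y n).2 * t ^ (C%:Z + 1)).
  by move=> Vy; apply: laurent_deriv_order (approxP y n) (bound y n Vy).
apply: (@null_seq_order _ C.+1) => n.
rewrite -[(_ - _) n]/((approx (f * g) n).2 -
  (f * (approx g n).2 + g * (approx f n).2)).
have := laurent_derivM (approxP f n) (approxP g n).
have := approx_in f n; have := approx_in g n; have := approx_in (f * g) n.
have := bound f n VfC; have := boundd f n VfC; have := boundd g n VgC.
have := approxP (f * g) n.
move: (approx f n) (approx g n) (approx (f * g) n) => [y1 s1] [y2 s2] [y3 s3] /=.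
move=> D3 Vs2 Vs1 Vy1 V3 V2 V1 D12.
have tC : t ^ (C.+1%:Z - n%:Z) = t ^ (C%:Z + 1) * t ^ (- n%:Z).
  by rewrite -expfzDr //; congr (_ ^ _); lia.
(* The first term compares [s3] with the product rule for the approximations; the others are the
   errors of replacing [f] and [g] by [y1] and [y2]. *)
have -> : (s3 - (f * s2 + g * s1)) * t ^ (C.+1%:Z - n%:Z) =
    (s3 - (y1 * s2 + y2 * s1)) * t ^ (C.+1%:Z - n%:Z)
    - (((f - y1) * t ^ (- n%:Z)) * (s2 * t ^ (C%:Z + 1))
     + ((g - y2) * t ^ (- n%:Z)) * (s1 * t ^ (C%:Z + 1))).
  by rewrite tC; ring.
apply: (place_sub hV); last by apply: (place_add hV); apply: (place_mul hV).
have -> : C.+1%:Z - n%:Z = (C%:Z - n%:Z) + 1 by lia.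
apply: laurent_deriv_order (laurent_derivB D3 D12) _.
have -> : (y3 - y1 * y2) * t ^ (C%:Z - n%:Z) =
    ((f - y1) * t ^ (- n%:Z)) * (g * t ^ C) + ((g - y2) * t ^ (- n%:Z)) * (y1 * t ^ C)
    - ((f * g - y3) * t ^ (- n%:Z)) * t ^ C.
  by rewrite expfzDr //; ring.
apply: (place_sub hV); last by apply: (place_mul hV) => //; exact: Vtn.
by apply: (place_add hV); apply: (place_mul hV).
Qed.

Lemma germ_derivC c : germ_deriv (iota c) = 0.
Proof.
rewrite -[RHS](_ : germ 0 = 0); last by rewrite /germ raddf0.
apply: germ_eq; rewrite subr0; apply: (@null_seq_order _ 1) => n.
have := laurent_deriv_order (laurent_derivB (laurent_derivC c) (approxP _ n)) (approx_in _ n).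
by move=> /(place_opp hV); rewrite sub0r mulNr opprK addrC.
Qed.

(** Since [t] has formal derivative 1, its sequence of derivatives differs from the constant
    sequence 1 by a null sequence, and 1 is not null. *)
Lemma germ_derivX : germ_deriv t != 0.
Proof.
apply/eqP => D0.
have Nt : null_seq (fun n => (approx t n).2).
  suff: (fun n => (approx t n).2) \in null_zmod by move/asboolP.
  rewrite -[X in X \in _]subr0 Quotient.idealrBE.
  by rewrite -/(germ _) -/(germ_deriv _) D0 raddf0.
have N1 : null_seq (fun n => 1 - (approx t n).2).
  apply: (@null_seq_order _ 1) => n; rewrite [1%:Z - _]addrC.
  by apply: laurent_deriv_order (laurent_derivB laurent_derivX (approxP t n)) (approx_in t n).
have [n /(_ n (leqnn n))] := null_seqB N1 (null_seqM (-1) Nt) 1.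
rewrite -[(_ - _) n]/(1 - _ - -1 * _) mulN1r opprK subrK mul1r.
exact: (@uniformizer_pos _ _ _ _ hV _ ht 0).
Qed.

Lemma germ_deriv_is_derivation : is_derivation iota germ_deriv.
Proof. by split; [exact: germ_derivD|exact: germ_derivM|exact: germ_derivC]. Qed.

Lemma kahler_uniformizer_neq0 (Om : kahler iota) : kd_d Om t != 0.
Proof.
have [phi phiE] := kd_univ Om germ_deriv_is_derivation.
by apply: contra_neq germ_derivX => dt0; rewrite phiE dt0 linear0.
Qed.

End NullSequences.

(** * Expansions along the two branches of a node *)

Section Series.
Variable k : fieldType.
Implicit Types F G H A : nat -> k.

Definition series_mul F G (n : nat) : k := \sum_(a < n.+1) F a * G (n - a)%N.

Definition vanish (n : nat) F : Prop := forall i, (i < n)%N -> F i = 0.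

Lemma vanish_weaken n m F : (m <= n)%N -> vanish n F -> vanish m F.
Proof. by move=> mn Fn i im; apply: Fn; apply: leq_trans mn. Qed.

Lemma series_mulBr F G H n :
  series_mul F (fun i => G i - H i) n = series_mul F G n - series_mul F H n.
Proof. by rewrite /series_mul -sumrB; apply: eq_bigr => a _; rewrite mulrBr. Qed.

Lemma vanish_mul m n F G : vanish m F -> vanish n G -> vanish (m + n) (series_mul F G).
Proof.
move=> Fm Gn i imn; rewrite /series_mul big1 // => a _.
have [am|ma] := ltnP a m; first by rewrite Fm // mul0r.
by have ai := ltn_ord a; rewrite Gn ?mulr0 //; lia.
Qed.

Lemma series_mul_lead m n F G : vanish m F -> vanish n G ->
  series_mul F G (m + n) = F m * G n.
Proof.
move=> Fm Gn; have mlt : (m < (m + n).+1)%N by lia.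
rewrite /series_mul (bigD1 (Ordinal mlt)) //= addKn big1 ?addr0 // => a am.
have {}am : nat_of_ord a != m by apply: contraNneq am => am; apply/eqP/val_inj.
have [lt_am|ma] := ltnP a m; first by rewrite Fm // mul0r.
by have alt := ltn_ord a; rewrite Gn ?mulr0 //; lia.
Qed.

Lemma series_order F : (forall n, F n = 0) \/ exists2 n, vanish n F & F n != 0.
Proof.
have [[n Fn]|F0] := pselect (exists n, F n != 0); last first.
  by left=> n; apply/eqP; apply: contrapT => /negP Fn; apply: F0; exists n.
right; have [m Fm minm] := ex_minnP (ex_intro (fun n => F n != 0) n Fn).
by exists m => // i; apply: contraTeq => /minm; rewrite -leqNgt.
Qed.

Lemma vanish_mulI a n A G : vanish a A -> A a != 0 ->
  vanish (a + n) (series_mul A G) -> vanish n G.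
Proof.
move=> Aa Aa0 AG; have [G0 i _|[m Gm Gm0] i lt_in] := series_order G; first exact: G0.
have [lt_mn|nm] := ltnP m n; last by apply: Gm; apply: leq_trans nm.
have /eqP : series_mul A G (a + m) = 0 by apply: AG; rewrite ltn_add2l.
by rewrite series_mul_lead // mulf_eq0 (negbTE Aa0) (negbTE Gm0).
Qed.

Lemma series_divide a A F M : vanish a A -> A a != 0 -> vanish a F ->
  exists G, vanish (a + M) (fun i => F i - series_mul A G i).
Proof.
move=> Aa Aa0 Fa; elim: M => [|M [G HG]].
  exists (fun=> 0); rewrite addn0 => i ia; rewrite Fa // /series_mul big1 ?subr0 // => j _.
  by rewrite mulr0.
(* [d] is the next coefficient of the quotient; [T] carries its negative to fit the difference in
   [series_mulBr]. *)
pose d := (F (a + M)%N - series_mul A G (a + M)) / A a.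
pose T i : k := if i == M then - d else 0.
exists (fun i => G i - T i) => i; rewrite addnS ltnS leq_eqVlt series_mulBr.
have TM : vanish M T by move=> j jM; rewrite /T ltn_eqF.
case/orP => [/eqP->|iaM].
  by rewrite (series_mul_lead Aa TM) /T eqxx /d; field.
rewrite (vanish_mul Aa TM) // subr0; exact: HG.
Qed.

End Series.

(** * Restriction of series in two variables to the axes *)

Section Axes.
Variable k : fieldType.
Implicit Types F G H : series2 k.

Definition axisX F (i : nat) : k := F i 0%N.
Definition axisY F (j : nat) : k := F 0%N j.

Lemma s2mulX F G i : axisX (s2mul F G) i = series_mul (axisX F) (axisX G) i.
Proof. by apply: eq_bigr => a _; rewrite big_ord1 subn0. Qed.

Lemma s2mulY F G j : axisY (s2mul F G) j = series_mul (axisY F) (axisY G) j.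
Proof. by rewrite /axisY /s2mul big_ord1 subnn; apply: eq_bigr. Qed.

Lemma s2XYE i j : s2mul (s2X k) (s2Y k) i j = ((i == 1%N) && (j == 1%N))%:R.
Proof.
rewrite /s2mul /s2X /s2Y.
case: i => [|i].
  by rewrite big_ord1 big1 // => b _; rewrite mul0r.
rewrite (bigD1 (inord 1)) //= inordK // [X in _ + X]big1 ?addr0; last first.
  move=> a a1; rewrite big1 // => b _.
  rewrite (_ : (nat_of_ord a == 1%N) = false) ?mul0r //.
  by apply: contraNF a1 => /eqP a1; apply/eqP/val_inj; rewrite /= inordK.
rewrite big_ord_recl big1 ?addr0 => [|b _]; last by rewrite mul0r.
by rewrite eqxx mul1r subn1 /= subn0 eqSS.
Qed.

Lemma s2XY_mul G i j :
  s2mul (s2mul (s2X k) (s2Y k)) G i j =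
    if (0 < i)%N && (0 < j)%N then G i.-1 j.-1 else 0.
Proof.
move: (s2mul (s2X k) (s2Y k)) s2XYE => P PE; rewrite /s2mul.
under eq_bigr do under eq_bigr do rewrite PE.
have [/andP[i0 j0]|nij] := ifPn; last first.
  rewrite big1 // => a _; rewrite big1 // => b _.
  rewrite (_ : _ && _ = false) ?mul0r //; apply: contraNF nij => /andP[/eqP a1 /eqP b1].
  by have := ltn_ord a; have := ltn_ord b; lia.
have i1 : (1 < i.+1)%N by []. have j1 : (1 < j.+1)%N by [].
rewrite (bigD1 (Ordinal i1)) //= [X in _ + X]big1 ?addr0; last first.
  move=> a a1; rewrite big1 // => b _.
  rewrite (_ : (nat_of_ord a == 1%N) = false) ?mul0r //.
  by apply: contraNF a1 => /eqP a1; apply/eqP/val_inj.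
rewrite (bigD1 (Ordinal j1)) //= [X in _ + X]big1 ?addr0; last first.
  move=> b b1; rewrite (_ : (nat_of_ord b == 1%N) = false) ?mul0r //.
  by apply: contraNF b1 => /eqP b1; apply/eqP/val_inj.
by rewrite mul1r !subn1.
Qed.

Lemma s2_ideal_axes F : s2_ideal F -> axisX F =1 (fun=> 0) /\ axisY F =1 (fun=> 0).
Proof.
by move=> [G ->]; split=> i; rewrite /axisX /axisY s2XY_mul ?andbF.
Qed.

(** Every mixed monomial is a multiple of xy, so modulo xy only the expansions on the two axes
    matter. *)
Lemma s2_ideal_powP n F :
  s2_ideal_pow n F <-> vanish n (axisX F) /\ vanish n (axisY F).
Proof.
split=> [[G [H [-> Hn]]]|[Fx Fy]].
  by split=> i ilt; rewrite /axisX /axisY /s2add s2XY_mul ?andbF add0r Hn ?addn0.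
exists (fun i j => F i.+1 j.+1), (fun i j => if (0 < i)%N && (0 < j)%N then 0 else F i j).
split.
  apply/funext => i; apply/funext => j; rewrite /s2add s2XY_mul.
  by case: ifP => [/andP[i0 j0]|]; rewrite ?addr0 ?add0r // !prednK.
move=> [|i] [|j] //=; first by move=> ?; exact: Fx.
  by rewrite add0n; apply: Fy.
by rewrite addn0; apply: Fx.
Qed.

End Axes.

(** * Branch expansions of the local ring *)

Section NodeCoordinates.
Variables (k : closedFieldType) (X : curve k) (x : pt X).
Implicit Types f g : ratfun X.

(** A [k]-algebra morphism from the local ring at [x] to k[[T]]. *)
Record branch_expansion (al : ratfun X -> nat -> k) : Prop := {
  expansion_const : forall c n, al (fun i => emb i c) n = if n is 0%N then c else 0;
  expansionD : forall f g, reg x f -> reg x g ->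
    forall n, al (fun i => f i + g i) n = al f n + al g n;
  expansionM : forall f g, reg x f -> reg x g ->
    forall n, al (fun i => f i * g i) n = series_mul (al f) (al g) n }.

(* The completed local ring of a node, embedded in the product k[[T]] x k[[T]]
   of its two branches. *)
Record node_expansion (al be : ratfun X -> nat -> k) : Prop := {
  expansion1 : branch_expansion al;
  expansion2 : branch_expansion be;
  expansion_pow : forall n f, reg x f ->
    max_ideal_pow x n f <-> vanish n (al f) /\ vanish n (be f);
  expansion_glue : forall f, al f 0%N = be f 0%N;
  expansion_dense : forall n (F G : nat -> k), F 0%N = G 0%N ->
    exists2 f, reg x f & vanish n (fun i => al f i - F i) /\
                         vanish n (fun i => be f i - G i) }.

Lemma node_expansion_sym al be : node_expansion al be -> node_expansion be al.
Proof.
case=> h1 h2 hp hg hd; split=> //.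
  by move=> n f rf; rewrite hp //; split=> -[].
by move=> n F G /esym /(hd n) [f rf []]; exists f.
Qed.

Lemma node_expansion_exists : node x -> exists al be, node_expansion al be.
Proof.
move=> [phi [hC hD hM hp hd]].
exists (fun f => axisX (phi f)), (fun f => axisY (phi f)).
have ax (F G : series2 k) : s2_ideal (s2sub F G) -> axisX F =1 axisX G /\ axisY F =1 axisY G.
  by move=> /s2_ideal_axes[hx hy]; split=> i; apply/eqP;
    rewrite -subr_eq0; apply/eqP; [exact: hx|exact: hy].
split=> //.
- split=> [c n|f g rf rg n|f g rf rg n].
  + by rewrite (ax _ _ (hC c)).1 /axisX /s2C; case: n.
  + by rewrite (ax _ _ (hD f g rf rg)).1.
  + by rewrite (ax _ _ (hM f g rf rg)).1 s2mulX.
- split=> [c n|f g rf rg n|f g rf rg n].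
  + by rewrite (ax _ _ (hC c)).2 /axisY /s2C; case: n.
  + by rewrite (ax _ _ (hD f g rf rg)).2.
  + by rewrite (ax _ _ (hM f g rf rg)).2 s2mulY.
- by move=> n f rf; rewrite hp // s2_ideal_powP.
- move=> n F G FG; have [f rf] := hd n (fun i j => if j == 0%N then F i else
     if i == 0%N then G j else 0).
  move=> /s2_ideal_powP[hx hy]; exists f => //; split=> i ilt.
    by have := hx i ilt.
  by have := hy i ilt; rewrite /axisY /s2sub /=; case: i ilt => // _; rewrite FG.
Qed.

Lemma reg_const0 : reg x (fun i => 0 : fld i).
Proof.
rewrite (_ : (fun i => 0) = (fun i => emb i 0)); first exact: reg_const.
by apply: functional_extensionality_dep => i; rewrite rmorph0.
Qed.

Lemma reg_const1 : reg x (fun i => 1 : fld i).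
Proof.
rewrite (_ : (fun i => 1) = (fun i => emb i 1)); first exact: reg_const.
by apply: functional_extensionality_dep => i; rewrite rmorph1.
Qed.

Lemma reg_add f g : reg x f -> reg x g -> reg x (fun i => f i + g i).
Proof.
move=> rf rg; rewrite (_ : (fun i => _) = (fun i => f i - (0 - g i))).
  by apply: reg_sub => //; apply: reg_sub => //; exact: reg_const0.
by apply: functional_extensionality_dep => i; rewrite sub0r opprK.
Qed.

Lemma expansionB al : branch_expansion al -> forall f g, reg x f -> reg x g ->
  forall n, al (fun i => f i - g i) n = al f n - al g n.
Proof.
move=> hal f g rf rg n; apply/eqP; rewrite -subr_eq0 opprB addrA subr_eq0.
rewrite -(expansionD hal) //; last exact: reg_sub.
by apply/eqP; congr (al _ n); apply: functional_extensionality_dep => i; rewrite subrK.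
Qed.

End NodeCoordinates.

(** * Points of the normalization over a point of the curve *)

Section Fibre.
Variables (k : closedFieldType) (X : curve k) (x : pt X).
Variable u : forall P : branch X, fld (tag P).
Hypothesis u_param : forall P : branch X, is_uniformizer (vring (tagged P)) (u P).
Implicit Types (f g h : ratfun X) (P Q : branch X).

Let place P : is_place (emb (tag P)) (vring (tagged P)) := vringP (tagged P).

Definition vanish_at P (n : nat) f : Prop :=
  vring (tagged P) (f (tag P) / u P ^+ n).

Definition zero_at P f : Prop := place_ideal (vring (tagged P)) (f (tag P)).

Lemma zero_atP P f : zero_at P f <-> vanish_at P 1 f.
Proof. exact: (place_idealP (place P) (u_param P)). Qed.

Lemma vanish_at0 P f : vanish_at P 0 f <-> vring (tagged P) (f (tag P)).
Proof. by rewrite /vanish_at expr0 divr1. Qed.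

Lemma vanish_at_weaken P n m f : (n <= m)%N -> vanish_at P m f -> vanish_at P n f.
Proof. exact: (uniformizer_weaken (place P) (u_param P)). Qed.

Lemma reg_nreg f : reg x f -> nreg x f.
Proof. by move=> + P; rewrite /fibre /= => + xE; rewrite -xE; exact: reg_vring. Qed.

Lemma nregB f g : nreg x f -> nreg x g -> nreg x (fun i => f i - g i).
Proof. by move=> Nf Ng P xP; apply: (place_sub (place P)); [exact: Nf|exact: Ng]. Qed.

Lemma nregM f g : nreg x f -> nreg x g -> nreg x (fun i => f i * g i).
Proof. by move=> Nf Ng P xP; apply: (place_mul (place P)); [exact: Nf|exact: Ng]. Qed.

Lemma nregX f n : nreg x f -> nreg x (fun i => f i ^+ n).
Proof. by move=> Nf P xP; apply: (place_exp (place P)); exact: Nf. Qed.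

Lemma max_ideal_pow_vanish n f P : fibre x P -> max_ideal_pow x n f -> vanish_at P n f.
Proof.
move=> xP; elim: n f => [|n IH] f /=; first by move=> /reg_nreg/(_ P xP)/vanish_at0.
move=> [N [a [b [ma mb ->]]]]; rewrite /vanish_at mulr_suml.
elim/big_ind: _ => [|y z|j _]; first exact: place0 (place P).
  exact: (place_add (place P)).
have u0 := uniformizer_neq0 (place P) (u_param P).
have /zero_atP : zero_at P (a j) by case: (ma j) => _ /(_ P xP).
rewrite /vanish_at expr1 => /(place_mul (place P))/(_ (IH _ (mb j))).
by congr vring; rewrite exprS; field; rewrite u0 expf_neq0.
Qed.

Lemma fibre_component (i : component X) : exists s : seq (npt i),
  forall p : npt i, nu (existT _ i p) = x -> p \in s.
Proof.
have /finite_seqP[s sE] : finite_set (existT _ i @^-1` fibre x : set (npt i)).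
  apply: finite_preimage; last exact: nu_fin.
  by move=> p q _ _ /eqP; rewrite eq_Tagged => /eqP.
by exists s => p xp; have : (existT _ i @^-1` fibre x) p by []; rewrite sE.
Qed.

(** Each of the finitely many points excludes at most one constant. An arbitrary function thus gives
    one that is regular over [x]. *)
Lemma fibre_avoid (i : component X) (y : fld i) : exists c, forall p : npt i,
  nu (existT _ i p) = x -> vring p (y - emb i c)^-1.
Proof.
have [s sP] := fibre_component i.
have [|c cs] := @closed_field_avoid k _ s (fun p c => ~ vring p (y - emb i c)^-1).
  by move=> p; apply: place_inv_sub_unique; exact: vringP.
by exists c => p /sP/cs/contrapT.
Qed.

Lemma fibre_pole (i : component X) : exists y : fld i, forall p : npt i,
  nu (existT _ i p) = x -> ~ vring p y.
Proof.
have [s sP] := fibre_component i.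
have [y ys] := common_pole s (@vringP _ X i).
by exists y => p /sP/ys.
Qed.

Definition supported (i : component X) (y : fld i) : ratfun X :=
  eqtype.dfwith (fun j => 0 : fld j) y.

Lemma supportedE i (y : fld i) : supported y i = y.
Proof. exact: eqtype.dfwith_in. Qed.

Lemma supported_nreg i (y : fld i) :
  (forall p : npt i, nu (existT _ i p) = x -> vring p y) -> nreg x (supported y).
Proof.
move=> Vy [j p] xp /=; rewrite /supported.
case: eqtype.dfwithP p xp => [p /Vy //|j' _ p _]; exact: place0 (vringP p).
Qed.

(** On different components the indicator of the first one works. On a common component some [y] is
    regular at [P] with a pole at [Q], by maximality of valuation rings, and [(y - c)^-1] serves for
    a suitable constant [c]. *)
Lemma fibre_separation P Q : P <> Q -> exists h,
  [/\ nreg x h, zero_at Q h & ~ zero_at P h].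
Proof.
case: P Q => [i p] [j q] pq; have [ij|ij] := eqVneq i j; last first.
  exists (supported (1 : fld i)); split.
  - by apply: supported_nreg => p' _; exact: place1 (vringP p').
  - rewrite /zero_at /= /supported eqtype.dfwith_out //; exact: place_ideal0 (vringP q).
  - rewrite /zero_at /= supportedE; exact: place_ideal1 (vringP p).
case: j / ij q pq => q pq.
have [y Vy NVy] : exists2 y, vring p y & ~ vring q y.
  apply: contrapT => NS; apply: pq; congr existT; apply: vring_inj.
  apply: (place_subset_eq (vringP p) (vringP q)) => y Vy.
  by apply: contrapT => NVy; apply: NS; exists y.
have [c cP] := fibre_avoid y.
have yc : y - emb i c != 0.
  apply: contra_not_neq NVy => /subr0_eq ->; exact: (place_const (vringP q)).
exists (supported (y - emb i c)^-1); split; first exact: supported_nreg.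
- split=> /=; rewrite supportedE.
    have [//|] := placeV_total (vringP q) (y - emb i c)^-1; rewrite invrK => Vyc.
    case: NVy; have := place_add (vringP q) Vyc (place_const (vringP q) c).
    by rewrite subrK.
  right; rewrite invrK => Vyc; apply: NVy.
  by have := place_add (vringP q) Vyc (place_const (vringP q) c); rewrite subrK.
- rewrite /zero_at /= supportedE => Iy; apply: (@place_ideal1 _ _ _ _ (vringP p)).
  rewrite -(divff yc); apply: (place_idealM (vringP p)) => //.
  exact: (place_sub (vringP p) Vy (place_const (vringP p) c)).
Qed.

(** An element of one valuation ring may have poles elsewhere over [x], but [(y - c)^-1] has none
    for suitable [c]; if that has residue [d], then [y] has residue [c + d^-1]. *)
Lemma fibre_residue P : fibre x P ->
    (forall f, nreg x f -> exists c, place_ideal (vring (tagged P)) (f (tag P) - emb (tag P) c)) ->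
  forall y, vring (tagged P) y -> exists c, vring (tagged P) ((y - emb (tag P) c) / u P).
Proof.
move=> xP hN y Vy; suff [c Ic] : exists c, place_ideal (vring (tagged P)) (y - emb (tag P) c).
  by exists c; apply/(place_idealP (place P) (u_param P)).
have [c cP] := fibre_avoid y; set z := y - _ in cP.
have Vz : vring (tagged P) z^-1 by case: (P) xP y Vy @z cP => i p xp y Vy z; apply.
have Nz : nreg x (supported z^-1) by apply: supported_nreg => p /cP.
have [d] := hN _ Nz; rewrite supportedE => Id.
have [->|z0] := eqVneq y (emb (tag P) c).
  by exists c; rewrite subrr; exact: place_ideal0 (place P).
have {}z0 : z != 0 by rewrite subr_eq0.
have Vz' : vring (tagged P) z.
  exact: (place_sub (place P) Vy (place_const (place P) c)).
have d0 : d != 0.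
  apply: contra_notN (place_ideal1 (place P)) => /eqP d0.
  move: Id; rewrite d0 rmorph0 subr0 => /(place_idealM (place P) Vz').
  by rewrite divff.
have ed0 : emb (tag P) d != 0 by rewrite fmorph_eq0.
exists (c + d^-1).
(* With [z = y - c], this is z - 1/d = -(z/d)(1/z - d). *)
have := place_idealM (place P) (place_mul (place P) Vz' (place_const (place P) (- d^-1))) Id.
by congr place_ideal; rewrite rmorphD rmorphN fmorphV /= -[y](subrK (emb (tag P) c)) -/z;
  field; rewrite z0 ed0.
Qed.

(** Multiplication by [w] brings the semilocal ring of the normalization into the local ring, where
    expansions make sense. A high power of the inverse of a function with poles at all points over
    [x] will do. *)
Lemma fibre_conductor : exists w, [/\ reg x w, forall P, fibre x P -> zero_at P w,
  forall i, w i != 0 & forall f, nreg x f -> reg x (fun i => w i * f i)].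
Proof.
have [n hn] := reg_conductor x.
pose z i := projT1 (cid (fibre_pole i)).
have zP P : fibre x P -> z (tag P) != 0 /\ place_ideal (vring (tagged P)) (z (tag P))^-1.
  move=> xP; have NV : ~ vring (tagged P) (z (tag P)).
    by rewrite /z; case: cid => y /= yP; apply: yP; case: (P) xP.
  split; first by apply: contra_not_neq NV => ->; exact: place0 (place P).
  split; last by right; rewrite invrK.
  by case: (placeV_total (place P) (z (tag P))).
(* [z i] can be zero only on components missing [x], where 1 keeps [w] invertible. The exponent
   exceeds [n] so that [w] vanishes over [x] even for [n = 0]. *)
pose w : ratfun X := fun i => if z i == 0 then 1 else (z i)^-1 ^+ n.+1.
have wN f : nreg x f -> reg x (fun i => w i * f i).
  move=> Nf; apply: hn => P xP; apply: (place_ideal_powP (u_param P)).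
  have [z0 Iz] := zP P xP; rewrite /w (negbTE z0).
  have Vz := place_ideal_in Iz; move/(place_idealP (place P) (u_param P)): Iz => Vzu.
  have := place_mul (place P) (place_exp (place P) n Vzu) (place_mul (place P) Vz (Nf P xP)).
  congr vring; rewrite exprS exprMn !exprVn; field.
  by rewrite !expf_neq0 // (uniformizer_neq0 (place P) (u_param P)).
have w0 i : w i != 0.
  by rewrite /w; case: ifPn => [_|z0]; rewrite ?oner_eq0 // expf_neq0 // invr_eq0.
have wJ P : fibre x P -> zero_at P w.
  move=> xP; have [z0 Iz] := zP P xP; rewrite /zero_at /w (negbTE z0) exprSr.
  by apply: (place_idealM (place P)) => //; apply: (place_exp (place P)); exact: place_ideal_in Iz.
exists w; split=> //.
have := wN (fun i => 1) (reg_nreg (reg_const1 x)); congr (reg x).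
by apply: functional_extensionality_dep => i; rewrite mulr1.
Qed.

(** [C] bounds the order of [w] at the finitely many points over [x]: it is the precision lost on
    division by [w]. *)
Lemma fibre_divide w : (forall i, w i != 0) -> exists C : nat,
  forall P m f, fibre x P -> vanish_at P (C + m) (fun i => w i * f i) -> vanish_at P m f.
Proof.
move=> w0; have /finite_seqP[s sE] := nu_fin x.
suff [C HC] : exists C, forall P, P \in s -> forall m (f : fld (tag P)),
    vring (tagged P) (w (tag P) * f / u P ^+ (C + m)) -> vring (tagged P) (f / u P ^+ m).
  exists C => P m f xP; apply: HC.
  by have : [set P | nu P = x] P by []; rewrite sE.
elim: s {sE} => [|Q s [C HC]]; first by exists 0%N.
have [D HD] := place_div (place Q) (u_param Q) (w0 (tag Q)).
exists (C + D)%N => P; rewrite inE => /orP[/eqP->|Ps] m f Vf.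
  by apply: HD; apply: (uniformizer_weaken (place Q) (u_param Q)) Vf; lia.
by apply: HC => //; apply: (uniformizer_weaken (place P) (u_param P)) Vf; lia.
Qed.

(** * The character of the semilocal ring given by one branch *)

Section Branch.
Variables (al : ratfun X -> nat -> k) (hal : branch_expansion x al).
Variables (w : ratfun X) (a : nat).
Hypotheses (Rw : reg x w) (wN : forall f, nreg x f -> reg x (fun i => w i * f i)).
Hypotheses (Aa : vanish a (al w)) (Aa0 : al w a != 0).

(** Multiplicativity of [al] is available on the local ring only; in w (w f g) = (w f)(w g) every
    factor lies there. *)
Lemma expansion_conductorM f g : nreg x f -> nreg x g ->
  series_mul (al w) (al (fun i => w i * (f i * g i))) =1
  series_mul (al (fun i => w i * f i)) (al (fun i => w i * g i)).
Proof.
move=> Nf Ng n; rewrite -!(expansionM hal) //; try exact: wN.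
  by congr (al _ n); apply: functional_extensionality_dep => i; ring.
by apply: wN; apply: nregM.
Qed.

(* If w f had order b < a, the order of w f^n would drop by a - b at each step. *)
Lemma expansion_conductor_vanish f : nreg x f -> vanish a (al (fun i => w i * f i)).
Proof.
move=> Nf; have [F0 i _|[b Fb Fb0]] := series_order (al (fun i => w i * f i)); first exact: F0.
have [ab|ba] := leqP a b; first exact: vanish_weaken Fb.
suff H n : exists o, [/\ vanish o (al (fun i => w i * f i ^+ n)),
    al (fun i => w i * f i ^+ n) o != 0 & (o + n <= a)%N].
  by have [o [_ _]] := H a.+1; lia.
elim: n => [|n [o [Go Go0 oa]]].
  exists a; rewrite addn0; split=> //;
    by rewrite (_ : (fun i => _) = w) //; apply: functional_extensionality_dep => i;
      rewrite mulr1.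
have E := expansion_conductorM Nf (nregX n Nf).
have Eb := series_mul_lead Fb Go; have Ev := vanish_mul Fb Go.
set H := al (fun i => w i * f i ^+ n.+1).
have HE : series_mul (al w) H =1
    series_mul (al (fun i => w i * f i)) (al (fun i => w i * f i ^+ n)).
  move=> j; rewrite -E; congr (series_mul _ (al _) j).
  by apply: functional_extensionality_dep => i; rewrite exprS.
have [H0|[o' Ho Ho0]] := series_order H.
  move: Eb; rewrite -HE /series_mul big1 => [/eqP|j _]; last by rewrite H0 mulr0.
  by rewrite eq_sym mulf_eq0 (negbTE Fb0) (negbTE Go0).
exists o'; split=> //; rewrite addnS.
suff : (a + o' <= b + o)%N by lia.
rewrite leqNgt; apply/negP => lt_bo.
move: (vanish_mul Aa Ho lt_bo); rewrite HE Eb => /eqP.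
by rewrite mulf_eq0 (negbTE Fb0) (negbTE Go0).
Qed.

(* The value of f on the branch: the constant term of al (w f) / al w. *)
Definition branch_value f : k := al (fun i => w i * f i) a / al w a.

Lemma branch_valueB f g : nreg x f -> nreg x g ->
  branch_value (fun i => f i - g i) = branch_value f - branch_value g.
Proof.
move=> Nf Ng; rewrite /branch_value -mulrBl -(expansionB hal); try exact: wN.
by congr (al _ a / _); apply: functional_extensionality_dep => i; rewrite mulrBr.
Qed.

Lemma branch_value_const c : branch_value (fun i => emb i c) = c.
Proof.
rewrite /branch_value (_ : (fun i => _) = (fun i => emb i c * w i)); last first.
  by apply: functional_extensionality_dep => i; rewrite mulrC.
rewrite (expansionM hal) //; last exact: reg_const.
have cv : vanish 0 (al (fun i => emb i c)) by [].
by rewrite -[a in series_mul _ _ a]add0n (series_mul_lead cv Aa) (expansion_const hal) mulfK.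
Qed.

Lemma branch_value1 : branch_value (fun i => 1) = 1.
Proof.
rewrite -[RHS](branch_value_const 1); congr branch_value.
by apply: functional_extensionality_dep => i; rewrite rmorph1.
Qed.

(** Comparison of coefficients of degree [a + a] in [expansion_conductorM]: all factors have order
    at least [a], so these are products of leading terms. *)
Lemma branch_valueM f g : nreg x f -> nreg x g ->
  branch_value (fun i => f i * g i) = branch_value f * branch_value g.
Proof.
move=> Nf Ng; have := expansion_conductorM Nf Ng (a + a).
have [Vf Vg Vfg] := And3 (expansion_conductor_vanish Nf) (expansion_conductor_vanish Ng)
  (expansion_conductor_vanish (nregM Nf Ng)).
rewrite !series_mul_lead // /branch_value => E.
by rewrite -(mulKf Aa0 (al (fun i => w i * (f i * g i)) a)) E; field.
Qed.

Lemma branch_valueX f n : nreg x f ->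
  branch_value (fun i => f i ^+ n) = branch_value f ^+ n.
Proof.
move=> Nf; elim: n => [|n IH]; first exact: branch_value1.
rewrite exprS -IH -branch_valueM //; last exact: nregX.
by congr branch_value; apply: functional_extensionality_dep => i; rewrite exprS.
Qed.

Lemma branch_value_conductor h : vanish 1 (al w) -> nreg x h ->
  branch_value (fun i => w i * h i) = 0.
Proof.
move=> w1 Nh; rewrite /branch_value (expansionM hal) //; last exact: wN.
by rewrite (vanish_mul w1 (expansion_conductor_vanish Nh)) ?mul0r // add1n.
Qed.

(** Here [al (w f)] has order above [a]. In al w * al (w f^(n+1)) = al (w f) * al (w f^n) the factor
    [al w] of order [a] cancels, so each step gains one order. *)
Lemma branch_value0_vanish f n : nreg x f -> branch_value f = 0 ->
  vanish (a + n) (al (fun i => w i * f i ^+ n)).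
Proof.
move=> Nf /eqP; rewrite mulf_eq0 invr_eq0 (negbTE Aa0) orbF => /eqP f0.
have Vf : vanish a.+1 (al (fun i => w i * f i)).
  move=> i; rewrite ltnS leq_eqVlt => /orP[/eqP-> //|].
  exact: expansion_conductor_vanish.
elim: n => [|n IH]; first by rewrite addn0; apply: expansion_conductor_vanish; exact: nregX.
apply: (vanish_mulI Aa Aa0); have := vanish_mul Vf IH; rewrite addSn -!addnS => Vm i /Vm.
rewrite -(expansion_conductorM Nf (nregX n Nf)) => <-; congr (series_mul _ (al _) i).
by apply: functional_extensionality_dep => j; rewrite exprS.
Qed.

End Branch.

End Fibre.

(** * The local ring of a node *)

Lemma max_ideal_pow1 (k : closedFieldType) (X : curve k) (x : pt X) (f : ratfun X) :
  max_ideal x f -> max_ideal_pow x 1 f.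
Proof.
move=> mf; exists 1%N, (fun=> f), (fun=> (fun=> 1)); split=> // [j|].
  exact: reg_const1.
by apply: functional_extensionality_dep => i; rewrite big_ord1 mulr1.
Qed.

(* The two branches of the completion give two independent linear forms on
   m / m^2, so m is not principal. *)
Lemma node_singular (k : closedFieldType) (X : curve k) (x : pt X) : node x -> singular x.
Proof.
move=> /node_expansion_exists[al [be hE]] [t mt tgen].
have lead ga : branch_expansion x ga -> forall f g, reg x f -> vanish 1 (ga g) ->
    reg x g -> ga (fun i => f i * g i) 1%N = ga f 0%N * ga g 1%N.
  move=> hga f g rf g1 rg; rewrite (expansionM hga) //.
  by rewrite -[1%N in LHS]add0n (series_mul_lead (m := 0)).
have [t1 t2] := (expansion_pow hE 1 mt.1).1 (max_ideal_pow1 mt).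
have [rt _] := mt.
(* An element of m is [g t], and [t] has no constant terms, so both linear coefficients of [t] are
   scaled by the common value of [g] at [x]. *)
have gen (F G : nat -> k) : F 0%N = 0 -> G 0%N = 0 -> exists2 c,
    F 1%N = c * al t 1%N & G 1%N = c * be t 1%N.
  move=> F0 G0; have FG0 : F 0%N = G 0%N by rewrite F0.
  have [f rf [fF fG]] := expansion_dense hE 2 FG0.
  have fE n : (n < 2)%N -> al f n = F n /\ be f n = G n.
    by move=> n2; split; apply/eqP; rewrite -subr_eq0; apply/eqP; [exact: fF|exact: fG].
  have mf : max_ideal x f.
    have : max_ideal_pow x 1 f.
      by apply/(expansion_pow hE) => //; split=> -[|//] _; rewrite ?(fE 0%N _).1 ?(fE 0%N _).2.
    move=> [N [p [q [mp rq fE']]]]; split=> // P xP; rewrite fE'.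
    elim/big_ind: _ => [|y z|j _]; first exact: place_ideal0 (vringP (tagged P)).
      exact: (place_idealD (vringP (tagged P))).
    rewrite mulrC; apply: (place_idealM (vringP (tagged P))).
      by have /reg_nreg := rq j; apply.
    by have [_] := mp j; apply.
  have [g rg fgt] := tgen f mf.
  exists (al g 0%N).
    by rewrite -(fE 1%N _).1 // fgt (lead al) //; exact: expansion1 hE.
  by rewrite -(fE 1%N _).2 // fgt (lead be) ?(expansion_glue hE) //; exact: expansion2 hE.
(* The linear parts of (T, 0) and (0, T) cannot both be multiples of that of [t]. *)
have [c A1 B1] := gen (fun n => (n == 1%N)%:R) (fun=> 0) erefl erefl.
have [d A2 B2] := gen (fun=> 0) (fun n => (n == 1%N)%:R) erefl erefl.
have c0 : c != 0 by apply: contra_eq_neq A1 => ->; rewrite mul0r /= oner_eq0.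
move/esym/eqP: B1; rewrite mulf_eq0 (negbTE c0) => /eqP bt0.
by move/eqP: B2; rewrite bt0 mulr0 /= oner_eq0.
Qed.

Section Node.
Variables (k : closedFieldType) (X : curve k) (x : pt X).
Variable u : forall P : branch X, fld (tag P).
Hypothesis u_param : forall P : branch X, is_uniformizer (vring (tagged P)) (u P).
Variables (w : ratfun X) (C : nat).
Hypotheses (Rw : reg x w) (wJ : forall P, fibre x P -> zero_at P w)
  (w0 : forall i, w i != 0) (wN : forall f, nreg x f -> reg x (fun i => w i * f i))
  (wC : forall P m f, fibre x P ->
     vanish_at u P (C + m) (fun i => w i * f i) -> vanish_at u P m f).
Implicit Types (f g h : ratfun X) (P Q : branch X).

Let place P : is_place (emb (tag P)) (vring (tagged P)) := vringP (tagged P).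

Lemma expansion_vanish_at al be : node_expansion x al be ->
  forall m f P, fibre x P -> reg x f -> vanish m (al f) -> vanish m (be f) ->
  vanish_at u P m f.
Proof.
move=> hE m f P xP rf Vf Wf; apply: (max_ideal_pow_vanish u_param xP).
by apply/(expansion_pow hE).
Qed.

Lemma expansion_conductor1 al be : node_expansion x al be -> vanish 1 (al w).
Proof.
by move=> hE; apply: ((expansion_pow hE 1 Rw).1 _).1; apply: max_ideal_pow1; split.
Qed.

Lemma nreg_divide f : (forall P, fibre x P -> vanish_at u P C f) ->
  nreg x (fun i => f i / w i).
Proof.
move=> Vf P xP; apply/(@vanish_at0 _ _ u P (fun i => f i / w i)); apply: wC => //.
rewrite addn0; move: (Vf P xP); congr (vanish_at _ _ _ _).
by apply: functional_extensionality_dep => i; rewrite mulrC divfK.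
Qed.

(** If [al w] were zero, then for [g] with expansion close to (T, 0) the product [w g] would have
    high order over [x]. So [g] would be [w * (w h)] with [h] in the semilocal ring, forcing
    [al g = 0]. *)
Lemma expansion_conductor_neq0 al be : node_expansion x al be ->
  exists2 a, vanish a (al w) & al w a != 0.
Proof.
move=> hE; have [A0|//] := series_order (al w).
have [hal hbe] := (expansion1 hE, expansion2 hE).
(* Three divisions by [w]: one from [w g] to [g], two from [g] to [h]. Adding 2 keeps the
   coefficient of T within the precision. *)
pose M := (C + (C + C)).+2.
have [g rg [gT g0]] := expansion_dense hE M (F := fun n => (n == 1%N)%:R) (G := fun=> 0) erefl.
have {}g0 : vanish M (be g) by move=> i /g0; rewrite subr0.
have Vg P : fibre x P -> vanish_at u P (C + C) g.
  move=> xP; apply: wC => //; apply: (vanish_at_weaken u_param (m := M)); first by rewrite /M; lia.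
  apply: (expansion_vanish_at hE) => //; first exact: reg_mul.
    by move=> i _; rewrite (expansionM hal) // /series_mul big1 // => j _; rewrite A0 mul0r.
  move=> i iM; rewrite (expansionM hbe) //.
  exact: (@vanish_mul _ 0 M (be w)).
have Nh : nreg x (fun i => g i / w i / w i).
  apply: nreg_divide => P xP; apply: wC => //.
  move: (Vg P xP); congr (vanish_at _ _ _ _).
  by apply: functional_extensionality_dep => i; rewrite mulrC divfK.
have := gT 1%N erefl; rewrite [al g](_ : _ = al (fun i => w i * (w i * (g i / w i / w i)))).
  rewrite (expansionM hal) //; last exact: wN.
  rewrite /series_mul big1 => [|j _]; last by rewrite A0 mul0r.
  by rewrite sub0r => /eqP; rewrite oppr_eq0 oner_eq0.
by congr al; apply: functional_extensionality_dep => i; field; exact: w0.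
Qed.

(** * The two characters at a node and the Jacobson radical *)

Section Branches.
Variables (al be : ratfun X -> nat -> k) (hE : node_expansion x al be) (a b : nat).
Hypotheses (Aa : vanish a (al w)) (Aa0 : al w a != 0)
  (Bb : vanish b (be w)) (Bb0 : be w b != 0).
Let hal := expansion1 hE.
Let hbe := expansion2 hE.
Let chi := branch_value al w a.
Let psi := branch_value be w b.

(** If [f] vanishes over [x], then [f ^+ C] is divisible by [w] in the semilocal ring, and both
    characters kill multiples of [w]. *)
Lemma branch_value_zero f : (forall P, fibre x P -> zero_at P f) -> chi f = 0 /\ psi f = 0.
Proof.
move=> f0; have Nf : nreg x f by move=> P /f0/place_ideal_in.
have Nh : nreg x (fun i => f i ^+ C / w i).
  apply: (@nreg_divide (fun i => f i ^+ C)) => P xP.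
  have := f0 P xP; move/(zero_atP u_param); rewrite /vanish_at expr1 => Vf.
  by rewrite -expr_div_n; apply: (place_exp (place P)).
have fC : (fun i => f i ^+ C) = (fun i => w i * (f i ^+ C / w i)).
  by apply: functional_extensionality_dep => i; rewrite mulrC divfK.
have chi0 := branch_value_conductor hal Rw wN Aa Aa0 (expansion_conductor1 hE) Nh.
have psi0 := branch_value_conductor hbe Rw wN Bb Bb0
  (expansion_conductor1 (node_expansion_sym hE)) Nh.
rewrite -fC in chi0 psi0.
rewrite (branch_valueX hal Rw wN Aa Aa0) // in chi0.
rewrite (branch_valueX hbe Rw wN Bb Bb0) // in psi0.
by move/eqP: chi0; move/eqP: psi0; rewrite !expf_eq0 => /andP[_ /eqP ?] /andP[_ /eqP ?].
Qed.

(** Both expansions of w f^(C+1) have order at least [C + 1]; division by [w] costs at most [C] and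
    leaves a zero of f^(C+1). *)
Lemma zero_branch_value f : nreg x f -> chi f = 0 -> psi f = 0 ->
  forall P, fibre x P -> zero_at P f.
Proof.
move=> Nf chi0 psi0 P xP; apply: (place_ideal_exp (place P) (n := C + 1)); first exact: Nf.
rewrite -[place_ideal _ _]/(zero_at P (fun i => f i ^+ (C + 1))); apply/(zero_atP u_param).
apply: wC => //; apply: (expansion_vanish_at hE) => //.
- by apply: wN; apply: nregX.
- apply: vanish_weaken (branch_value0_vanish hal Rw wN Aa Aa0 (n := C + 1) Nf chi0); lia.
- apply: vanish_weaken (branch_value0_vanish hbe Rw wN Bb Bb0 (n := C + 1) Nf psi0); lia.
Qed.

(** [e] is [g / w], where [g] approximates (al w, 0). Since g (g - w) has high order, e (e - 1) is
    regular over [x], and so is [e], valuation rings being integrally closed. *)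
Lemma branch_idempotent : exists e, [/\ nreg x e, chi e = 1 & psi e = 0].
Proof.
(* [C + C] pays for two divisions by [w]; [a] and [b] make the coefficients read by [chi] and [psi]
   exact. *)
pose M := (C + C + a + b).+1.
have AB0 : al w 0%N = 0 by apply: (expansion_conductor1 hE).
have [g rg [gA gB]] := expansion_dense hE M (F := al w) (G := fun=> 0) AB0.
have {}gB : vanish M (be g) by move=> i /gB; rewrite subr0.
have Vgg P : fibre x P -> vanish_at u P (C + (C + 0)) (fun i => g i * (g i - w i)).
  have rgw : reg x (fun i => g i - w i) by exact: reg_sub.
  move=> xP; apply: (vanish_at_weaken u_param (m := M)); first by rewrite /M; lia.
  apply: (expansion_vanish_at hE) => //; first exact: reg_mul.
    move=> i iM; rewrite (expansionM hal) //; apply: (@vanish_mul _ 0 M) => //.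
    by move=> j jM; rewrite (expansionB hal) //; exact: gA.
  move=> i iM; rewrite (expansionM hbe) //; apply: (@vanish_mul _ M 0) => //.
  by rewrite addn0.
have Ne : nreg x (fun i => g i / w i).
  move=> P xP; set e := g (tag P) / w (tag P).
  have Vee : vring (tagged P) (e * (e - 1)).
    rewrite -[e * _]/((fun i => g i / w i * (g i / w i - 1)) (tag P)).
    apply/(vanish_at0 u); do 2!apply: wC => //.
    move: (Vgg P xP); congr (vanish_at _ _ _ _); apply: functional_extensionality_dep => i.
    by field; exact: w0.
  have [//|Ve'] := placeV_total (place P) e.
  have [e0|e0] := eqVneq e 0; first by rewrite e0; exact: place0 (place P).
  (* e = e^-1 * e (e - 1) + 1. *)
  have := place_add (place P) (place_mul (place P) Ve' Vee) (place1 (place P)).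
  by rewrite mulKf // subrK.
have we : (fun i => w i * (g i / w i)) = g.
  by apply: functional_extensionality_dep => i; rewrite mulrC divfK.
exists (fun i => g i / w i); split=> //; rewrite /chi /psi /branch_value we.
  have -> : al g a = al w a by apply/eqP; rewrite -subr_eq0; apply/eqP/gA; rewrite /M; lia.
  by rewrite divff.
by rewrite gB ?mul0r // /M; lia.
Qed.

(** (f - chi f) e is killed by both characters, hence vanishes at [P], where [e] does not. *)
Lemma nreg_branch_value f P e : nreg x f -> fibre x P ->
  nreg x e -> chi e = 1 -> psi e = 0 -> ~ zero_at P e ->
  place_ideal (vring (tagged P)) (f (tag P) - emb (tag P) (chi f)).
Proof.
move=> Nf xP Ne chi1 psi0 ne0.
have Nc : nreg x (fun i => emb i (chi f)) by apply: reg_nreg; exact: reg_const.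
have Nfc := nregB Nf Nc.
have := zero_branch_value (nregM Nfc Ne) _ _ xP.
rewrite /chi /psi (branch_valueM hal Rw wN Aa Aa0) // (branch_valueM hbe Rw wN Bb Bb0) //.
rewrite (branch_valueB hal a wN) // (branch_value_const hal Rw Aa Aa0) subrr mul0r.
rewrite -/psi psi0 mulr0 => /(_ erefl erefl).
by case/(place_ideal_prime (place P) (Nfc P xP) (Ne P xP)).
Qed.

(** Every function regular over [x] takes the value of [chi] at both points, so none separates
    them. *)
Lemma branch_unique P Q e : fibre x P -> fibre x Q ->
  nreg x e -> chi e = 1 -> psi e = 0 -> ~ zero_at P e -> ~ zero_at Q e -> P = Q.
Proof.
move=> xP xQ Ne chi1 psi0 Pe Qe; apply: contrapT => PQ.
have [h [Nh Qh Ph]] := fibre_separation x PQ.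
have IP := nreg_branch_value Nh xP Ne chi1 psi0 Pe.
have IQ := nreg_branch_value Nh xQ Ne chi1 psi0 Qe.
apply: Ph; have chi0 : chi h = 0.
  by apply: (place_const_unique (place Q) IQ); rewrite rmorph0 subr0.
by move: IP; rewrite chi0 rmorph0 subr0.
Qed.

(* al (w f) = al w * G1 and be (w f) = be w * G2 up to high order, and an
   element of the local ring with expansion (G1, G2) approximates f. *)
Lemma reg_zero f : (forall P, fibre x P -> zero_at P f) -> reg x f.
Proof.
move=> f0; have Nf : nreg x f by move=> P /f0/place_ideal_in.
have [n hn] := reg_conductor x; pose M := (C + n).+1.
have [chi0 psi0] := branch_value_zero f0.
have quot ga c : branch_expansion x ga -> vanish c (ga w) -> ga w c != 0 ->
    branch_value ga w c f = 0 ->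
    exists2 G, vanish M (fun i => ga (fun i => w i * f i) i - series_mul (ga w) G i) & G 0%N = 0.
  move=> hga Cc Cc0 val0.
  have Vf := expansion_conductor_vanish hga Rw wN Cc Cc0 Nf.
  have [G HG] := series_divide M Cc Cc0 Vf.
  exists G; first by apply: vanish_weaken HG; lia.
  have lt_c : (c < c + M)%N by rewrite /M; lia.
  (* The coefficient of degree [c] gives [G 0 = 0], so that [G1] and [G2] glue. *)
  have := HG c lt_c; rewrite -[c in series_mul _ _ c]addn0 (series_mul_lead Cc) //.
  move/eqP: val0; rewrite mulf_eq0 invr_eq0 (negbTE Cc0) orbF => /eqP ->.
  by rewrite sub0r => /eqP; rewrite oppr_eq0 mulf_eq0 (negbTE Cc0) => /eqP.
have [G1 HG1 G10] := quot _ _ hal Aa Aa0 chi0.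
have [G2 HG2 G20] := quot _ _ hbe Bb Bb0 psi0.
have G12 : G1 0%N = G2 0%N by rewrite G10.
have [g rg [gG1 gG2]] := expansion_dense hE M G12.
have approx ga G : branch_expansion x ga ->
    vanish M (fun i => ga (fun i => w i * f i) i - series_mul (ga w) G i) ->
    vanish M (fun i => ga g i - G i) -> vanish M (ga (fun i => w i * (f i - g i))).
  move=> hga HG gG i iM.
  rewrite (_ : (fun i => _) = (fun i => w i * f i - w i * g i)); last first.
    by apply: functional_extensionality_dep => j; rewrite mulrBr.
  rewrite (expansionB hga); [|exact: wN|exact: reg_mul].
  rewrite (expansionM hga Rw rg) (subr0_eq (HG i iM)) -series_mulBr.
  apply: (@vanish_mul _ 0 M) => // j jM.
  by rewrite -opprB gG // oppr0.
have Nfg : nreg x (fun i => f i - g i) by apply: nregB => //; exact: reg_nreg.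
(* [f - g] has order at least [n] over [x], where [reg_conductor] applies. *)
have rfg : reg x (fun i => f i - g i).
  apply: hn => P xP; apply: (place_ideal_powP (u_param P)).
  apply: (@wC P n (fun i => f i - g i)) => //.
  apply: (vanish_at_weaken u_param (m := M)); first by rewrite /M; lia.
  apply: (expansion_vanish_at hE) => //; first exact: wN.
    exact: approx hal HG1 gG1.
  exact: approx hbe HG2 gG2.
have := reg_add rfg rg; congr (reg x).
by apply: functional_extensionality_dep => i; rewrite subrK.
Qed.

End Branches.
End Node.

(** * Residues and the comparison of the two conditions *)

Section Residue.
Variables (k K : fieldType) (iota : {rmorphism k -> K}) (V : set K) (t : K).
Hypotheses (hV : is_place iota V) (ht : is_uniformizer V t).
Variable Om : kahler iota.
Hypothesis dt0 : kd_d Om t != 0.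
Implicit Types (w : Om) (p : {poly k}) (c : k).

Let t0 : t != 0 := uniformizer_neq0 hV ht.

(** Multiplying by [t] and removing the constant leaves the same expression for a shorter
    polynomial; then [c / t] is regular only for [c = 0]. *)
Lemma polar_poly_eq0 p : V ((map_poly iota p).[t^-1] / t) -> p = 0.
Proof.
elim/poly_ind: p => [//|p c IH] Vp.
have E : (map_poly iota (p * 'X + c%:P)).[t^-1] = (map_poly iota p).[t^-1] / t + iota c.
  by rewrite rmorphD rmorphM /= map_polyX map_polyC hornerMXaddC.
have p0 : p = 0.
  apply: IH; have := place_sub hV (place_mul hV Vp (uniformizer_in ht)) (place_const hV c).
  by rewrite divfK // E addrK.
move: Vp; rewrite E p0 rmorph0 horner0 !mul0r add0r => /(place_idealP hV ht).
by move=> /(place_ideal_const hV) ->; rewrite add0r.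
Qed.

Lemma principal_part_unique w p q :
  principal_part V t w p -> principal_part V t w q -> p = q.
Proof.
move=> [g wg Vg] [h wh Vh].
have gh : g = h.
  move/eqP: wg; rewrite wh -subr_eq0 -scalerBl scaler_eq0 (negbTE dt0) orbF subr_eq0.
  by move/eqP.
apply/eqP; rewrite -subr_eq0; apply/eqP/polar_poly_eq0; rewrite -{}gh in Vh.
have := place_sub hV Vh Vg; congr V.
by rewrite rmorphB hornerD hornerN; ring.
Qed.

Lemma principal_partC w c : principal_part V t w c%:P <->
  exists2 g, w = g *: kd_d Om t & V (g - iota c / t).
Proof. by rewrite /principal_part map_polyC hornerC. Qed.

Lemma residueE w c : principal_part V t w c%:P -> residue V t w = c.
Proof.
move=> wc; apply: xget_unique; first by exists c%:P; rewrite ?coefC.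
by move=> _ [p wp ->]; rewrite (principal_part_unique wp wc) coefC.
Qed.

Lemma principal_part_scale w c f d : V f -> place_ideal V (f - iota d) ->
  principal_part V t w c%:P -> principal_part V t (f *: w) (d * c)%:P.
Proof.
move=> Vf Id /principal_partC [g wg Vg]; apply/principal_partC.
exists (f * g); first by rewrite wg scalerA.
move/(place_idealP hV ht): Id => Id.
(* f g - d c / t = f (g - c / t) + c (f - d) / t. *)
have := place_add hV (place_mul hV Vf Vg) (place_mul hV Id (place_const hV c)).
by congr V; rewrite rmorphM; field.
Qed.

(** [f] has at most a simple zero, so division by it creates at most a simple pole, whose
    coefficient is the residue class of t g / f. *)
Lemma simple_pole_divide w f : f != 0 -> V (t / f) ->
    (forall y, V y -> exists c, V ((y - iota c) / t)) ->
  regular_diff V t (f *: w) -> at_most_simple_pole V t w.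
Proof.
move=> f0 Vf res [g fw]; rewrite rmorph0 horner0 mul0r subr0 => Vg.
have [c Vc] := res _ (place_mul hV Vf Vg).
exists c; apply/principal_partC; exists (g / f).
  by rewrite mulrC -scalerA -fw scalerA mulVf // scale1r.
by move: Vc; congr V; field; rewrite t0 f0.
Qed.

End Residue.

(** * Points over a node and the conductor *)

Section NodeStructure.
Variables (k : closedFieldType) (X : curve k) (x : pt X).
Variable u : forall P : branch X, fld (tag P).
Hypothesis u_param : forall P : branch X, is_uniformizer (vring (tagged P)) (u P).
Hypothesis node_x : node x.
Implicit Types (f g h : ratfun X) (P Q : branch X).

Let place P : is_place (emb (tag P)) (vring (tagged P)) := vringP (tagged P).

Lemma node_structure : [/\ exists P Q, P <> Q /\ fibre x = [set P; Q],
  forall P, fibre x P -> forall y, vring (tagged P) y ->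
    exists c, vring (tagged P) ((y - emb (tag P) c) / u P) &
  forall f, (forall P, fibre x P -> zero_at P f) -> reg x f].
Proof.
have [al [be hE]] := node_expansion_exists node_x.
have hE' := node_expansion_sym hE.
have [w [Rw wJ w0 wN]] := fibre_conductor x u_param.
have [C wC] := fibre_divide x u_param w0.
have [a Aa Aa0] := expansion_conductor_neq0 u_param Rw w0 wN wC hE.
have [b Bb Bb0] := expansion_conductor_neq0 u_param Rw w0 wN wC hE'.
have [e [Ne chi1 psi0]] := branch_idempotent u_param Rw wJ w0 wC hE Aa0 Bb0.
have [hal hbe] := (expansion1 hE, expansion2 hE).
have N1 := reg_nreg (reg_const1 x).
(* [e] and [e'] cut the fibre in two: their sum is 1 and their product is killed by both characters,
   so exactly one of them vanishes at each point over [x]. *)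
pose e' : ratfun X := fun i => 1 - e i.
have Ne' : nreg x e' by exact: nregB.
have chi0' : branch_value al w a e' = 0.
  by rewrite (branch_valueB hal a wN) // (branch_value1 hal Rw Aa Aa0) chi1 subrr.
have psi1' : branch_value be w b e' = 1.
  by rewrite (branch_valueB hbe b wN) // (branch_value1 hbe Rw Bb Bb0) psi0 subr0.
have some P : ~ (zero_at P e /\ zero_at P e').
  move=> [Z Z']; apply: (place_ideal1 (place P)).
  by have := place_idealD (place P) Z Z'; rewrite /e' addrC subrK.
have zero_or P : fibre x P -> zero_at P e \/ zero_at P e'.
  move=> xP; apply: (place_ideal_prime (place P)); [exact: Ne|exact: Ne'|].
  apply: (zero_branch_value u_param Rw wN wC hE Aa Aa0 Bb Bb0 
    (f := fun i => e i * e' i)) => //; first exact: nregM.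
    by rewrite (branch_valueM hal Rw wN Aa Aa0) // chi0' mulr0.
  by rewrite (branch_valueM hbe Rw wN Bb Bb0) // psi0 mul0r.
have bv0 := branch_value_zero u_param Rw wJ w0 wN wC hE Aa Aa0 Bb Bb0.
have [P [xP Pe]] : exists P, fibre x P /\ ~ zero_at P e.
  apply: contrapT => NP; have [] := bv0 e.
    by move=> P xP; apply: contrapT => NZ; apply: NP; exists P.
  by rewrite chi1 => /eqP; rewrite oner_eq0.
have [Q [xQ Qe]] : exists Q, fibre x Q /\ ~ zero_at Q e'.
  apply: contrapT => NP; have [] := bv0 e'.
    by move=> Q xQ; apply: contrapT => NZ; apply: NP; exists Q.
  by rewrite psi1' => _ /eqP; rewrite oner_eq0.
split.
- exists P, Q; split; first by move=> PQ; case: (zero_or P xP) => //; rewrite PQ.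
  apply/seteqP; split=> [S xS|S [->|->] //].
  have [Se|Se] := zero_or S xS; [right|left]; apply/esym.
    apply: (branch_unique u_param Rw wN wC hE' Bb Bb0 Aa Aa0 xQ xS Ne') => //.
    by move=> Se'; apply: (some S).
  apply: (branch_unique u_param Rw wN wC hE Aa Aa0 Bb Bb0 xP xS Ne) => //.
  by move=> Se'; apply: (some S).
- move=> S xS; apply: (fibre_residue u_param xS) => f Nf.
  have [Se|Se] := zero_or S xS.
    exists (branch_value be w b f).
    apply: (nreg_branch_value u_param Rw wN wC hE' Bb Bb0 Aa Aa0 Nf xS Ne') => //.
    by move=> Se'; apply: (some S).
  exists (branch_value al w a f).
  apply: (nreg_branch_value u_param Rw wN wC hE Aa Aa0 Bb Bb0 Nf xS Ne) => //.
  by move=> Se'; apply: (some S).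
- exact: (reg_zero u_param Rw wJ w0 wN wC hE Aa Aa0 Bb Bb0).
Qed.

(** J is an ideal of the semilocal ring inside the local ring. Conversely, for [f] in the conductor,
    f h takes one value at both points; with [h] vanishing at one of them only, this value is 0 and
    [f] vanishes at the other. *)
Lemma node_conductorP f : conductor x f <-> forall P, fibre x P -> zero_at P f.
Proof.
have [[P [Q [PQ xE]]] _ Jreg] := node_structure; split.
  move=> [rf fN] R xR; have [S [SR xS]] : exists S, S <> R /\ fibre x S.
    move: xR; rewrite xE => -[->|->].
      by exists Q; split; [exact: nesym|right].
    by exists P; split; [|left].
  have [h [Nh Sh Rh]] := fibre_separation x (nesym SR).
  have [d dP] := reg_local (fN h Nh).
  have d0 : d = 0.
    have Sfh : place_ideal (vring (tagged S)) (f (tag S) * h (tag S)).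
      by apply: (place_idealM (place S)) => //; exact: (reg_nreg rf).
    apply: (place_const_unique (place S) (dP S xS)).
    by rewrite rmorph0 subr0.
  have := dP R xR; rewrite d0 rmorph0 subr0.
  by case/(place_ideal_prime (place R) (reg_nreg rf xR) (Nh R xR)).
move=> f0; split; first exact: Jreg.
move=> h Nh; apply: Jreg => R xR; rewrite /zero_at mulrC.
by apply: (place_idealM (place R)); [exact: Nh|exact: f0].
Qed.

(** f = h / (1/u - c), with [c] making 1 / (1/u - c) regular over [x] and [h] a unit at [P]
    vanishing at the other point. *)
Lemma node_conductor_order1 P : fibre x P -> exists f,
  [/\ conductor x f, f (tag P) != 0 & vring (tagged P) (u P / f (tag P))].
Proof.
move=> xP; have [[P1 [P2 [P12 xE]]] _ _] := node_structure.
have [Q [QP xQ xPQ]] : exists Q, [/\ Q <> P, fibre x Q &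
    forall S, fibre x S -> S = P \/ S = Q].
  have [->|->] : [set P1; P2] P by rewrite -xE.
    by exists P2; split=> [||S]; [exact: nesym|rewrite xE; right|rewrite xE => -[]; auto].
  by exists P1; split=> [||S]; [|rewrite xE; left|rewrite xE => -[]; auto].
have [h [Nh Qh Ph]] := fibre_separation x (nesym QP).
have [h0 Vh'] := place_unit_inv (place P) (Nh P xP) Ph.
have u0 := uniformizer_neq0 (place P) (u_param P).
have Vu := uniformizer_in (u_param P).
have [c cP] := fibre_avoid x (u P)^-1; set z := _^-1 - _ in cP.
have NVz : ~ vring (tagged P) z.
  move=> Vz; case: (u_param P) => _ + _; apply.
  by have := place_add (place P) Vz (place_const (place P) c); rewrite subrK.
have z0 : z != 0 by apply: contra_not_neq NVz => ->; exact: place0 (place P).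
have Nz : nreg x (supported z^-1) by exact: supported_nreg.
exists (fun i => supported z^-1 i * h i); split.
- apply/node_conductorP => S xS; case: (xPQ S xS) => ->.
    rewrite /zero_at mulrC; apply: (place_idealM (place P)); first exact: Nh.
    rewrite supportedE; split; last by right; rewrite invrK.
    by have := Nz P xP; rewrite supportedE.
  by apply: (place_idealM (place Q)) => //; apply: Nz.
- by rewrite supportedE mulf_neq0 // invr_eq0.
- rewrite supportedE.
  (* u / f = (1 - c u) / h. *)
  have := place_mul (place P) (place_sub (place P) (place1 (place P))
    (place_mul (place P) (place_const (place P) c) Vu)) Vh'.
  congr vring; rewrite /z; field.
  rewrite h0 u0 andbT /=; apply: contra_neq z0 => E; rewrite /z.
  by apply: (mulfI u0); rewrite mulrBr divff // mulr0 -E; ring.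
Qed.

End NodeStructure.

Theorem lemma4p6 (k : closedFieldType) (char0 : [pchar k] =i pred0)
  (X : curve k) (nodalX : nodal X)
  (Om : forall i : component X, kahler (emb i))
  (u : forall P : branch X, fld (tag P))
  (u_param : forall P : branch X, is_uniformizer (vring (tagged P)) (u P))
  (eta : merodiff Om) :
  conductor_balanced u eta <-> residue_balanced u eta.
Proof.
have plc (P : branch X) : is_place (emb (tag P)) (vring (tagged P)) := vringP (tagged P).
have res x (P : branch X) : node x -> fibre x P -> forall y, vring (tagged P) y ->
    exists c, vring (tagged P) ((y - emb (tag P) c) / u P).
  by move=> nx xP; have [_ + _] := node_structure u_param nx; apply.
have du0 x (P : branch X) : node x -> fibre x P -> kd_d (Om (tag P)) (u P) != 0.
  by move=> nx xP; apply: kahler_uniformizer_neq0 (plc P) (u_param P) (res x P nx xP) _.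
have sum2 (P Q : branch X) (F : branch X -> k) : P <> Q -> \sum_(S \in [set P; Q]) F S = F P + F Q.
  move=> PQ; rewrite fsbigU0 ?fsbig_set1 //; [exact: finite_set1..|].
  by move=> S [/= -> /PQ].
split=> [bal x nx|bal x sx].
  have [annih dual] := bal x (node_singular nx).
  have [[P [Q [PQ xE]]] _ _] := node_structure u_param nx.
  (* A conductor element with at most a simple zero at [S] bounds the pole of [eta] there. *)
  have simple S : fibre x S -> simple_pole_at u eta S.
    move=> xS; have [f [cf f0 Vf]] := node_conductor_order1 u_param nx xS.
    apply: (simple_pole_divide (plc S) (u_param S) f0 Vf); first exact: res nx xS.
    exact: annih cf S xS.
  exists P, Q; split=> //; [by apply: simple; rewrite xE; left|
    by apply: simple; rewrite xE; right|].
  have := dual _ (reg_const1 x); rewrite xE sum2 //.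
  by rewrite /residue_at /= !scale1r.
have nx : node x by case: (nodalX x).
have [P [Q [PQ xE [cP HP] [cQ HQ] PQ0]]] := bal x nx.
have part S : fibre x S -> exists c, principal_part (vring (tagged S)) (u S) (eta (tag S)) c%:P.
  by rewrite xE => -[->|->]; [exists cP|exists cQ].
have xP : fibre x P by rewrite xE; left.
have xQ : fibre x Q by rewrite xE; right.
split=> [f cf S xS|f rf].
  have [c Hc] := part S xS; have f0 := (node_conductorP u_param nx f).1 cf S xS.
  have f00 : place_ideal (vring (tagged S)) (f (tag S) - emb (tag S) 0).
    by rewrite rmorph0 subr0.
  have := principal_part_scale (plc S) (u_param S) (place_ideal_in f0) f00 Hc.
  by rewrite mul0r polyC0.
(* [d] is the common value of [f] at both points, so the residue sum of [f eta] is [d] times that of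
   [eta]. *)
have [d dP] := reg_local rf.
have resE S c : fibre x S -> principal_part (vring (tagged S)) (u S) (eta (tag S)) c%:P ->
    residue_at u eta S = c /\ residue_at u (fun i => f i *: eta i) S = d * c.
  move=> xS Hc; have rE := residueE (plc S) (u_param S) (du0 x S nx xS).
  split; apply: rE => //.
  by apply: (principal_part_scale (plc S) (u_param S)) => //; [exact: (reg_nreg rf)|exact: dP].
have [EP EP'] := resE P cP xP HP; have [EQ EQ'] := resE Q cQ xQ HQ.
by rewrite xE sum2 // EP' EQ' -mulrDr -EP -EQ PQ0 mulr0.
Qed.
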